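(* Let $(X,d)$ be a geometrically doubling metric space equipped with an upper doubling measure $\mu$ with dominating function $\lambda$. Let $T$ be a Calderón-Zygmund operator that is bounded on $L^2(\mu)$, and let $0<\eta<1$. Then there exists a constant $C>0$ such that for any bounded function $f$ with compact support and any $x\in X$, $$T_*f(x)\le C\big(M_{\eta,6}(Tf)(x)+M_{(5)}f(x)\big).$$
   Context: $B(x,r)=\{y: d(y,x)<r\}$. A ball $B$ has center $x_B$ and radius $r_B$, and $aB=B(x_B,ar_B)$. Geometrically doubling: there is $N\in\mathbb{N}$ such that every ball $B(x,r)$ can be covered by at most $N$ balls of radius $r/2$. Upper doubling: $\mu$ is a Borel measure and there is $\lambda:X\times(0,\infty)\to(0,\infty)$ such that $r\mapsto\lambda(x,r)$ is increasing for each $x$; $\lambda(x,2r)\le C_\lambda\lambda(x,r)$; $\mu(B(x,r))\le\lambda(x,r)$; and $\lambda(x,r)\approx\lambda(y,r)$ (uniform constants) whenever $d(x,y)\le r$. Calderón-Zygmund kernel: $K\in L^1_{\mathrm{loc}}(X\times X\setminus\{x=y\})$ such that for some constants $C,c>0$ and $0<\delta\le1$: (i) $|K(x,y)|\le C\min\{\frac1{\lambda(x,d(x,y))},\frac1{\lambda(y,d(x,y))}\}$; (ii) $|K(x,y)-K(x',y)|+|K(y,x)-K(y,x')|\le C\frac{d(x,x')^\delta}{d(x,y)^\delta\lambda(x,d(x,y))}$ if $d(x,x')\le c\,d(x,y)$. A linear operator $T$ is a Calderón-Zygmund operator with kernel $K$ if $Tf(x)=\int_XK(x,y)f(y)\,d\mu(y)$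 for all $f\in L^\infty(\mu)$ with bounded support and $x\notin\operatorname{supp}f$. $T_*f(x)=\sup_{\epsilon>0}|T_\epsilon f(x)|$ with $T_\epsilon f(x)=\int_{d(x,y)\ge\epsilon}K(x,y)f(y)\,d\mu(y)$. For $p>0$, $\rho\ge 1$: $M_{p,\rho}f(x)=\sup_{Q\ni x}\big(\frac1{\mu(\rho Q)}\int_Q|f|^p\,d\mu\big)^{1/p}$, the supremum being over balls $Q$ containing $x$; and $M_{(\rho)}f=M_{1,\rho}f$. *)

(* Defs.v *)
From HB Require Import structures.
From mathcomp Require Import all_boot all_order all_algebra.
From mathcomp Require Import all_classical all_reals all_analysis.
From mathcomp Require Import complex.

Set Implicit Arguments.
Unset Strict Implicit.
Unset Printing Implicit Defensive.

Import Order.TTheory GRing.Theory Num.Theory.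
Import numFieldNormedType.Exports.
Import ComplexField.Normc.

Local Open Scope classical_set_scope.
Local Open Scope ring_scope.
Local Open Scope complex_scope.

(* Metric and sigma-algebra are independent data here; they are related by
   [borel_space] below. *)
#[short(type="measurableMetricType")]
HB.structure Definition MeasurableMetric (d : measure_display) (R : realType) :=
  { X of Metric R X & Measurable d X }.

Definition borel_space (d : measure_display) (R : realType)
    (X : measurableMetricType d R) : Prop :=
  @measurable d X = <<s @open X >>.

Definition geometrically_doubling (R : realType) (X : metricType R) : Prop :=
  exists N : nat, forall (x : X) (r : R), 0 < r ->
    exists s : seq X, (size s <= N)%N /\
      ball x r `<=` \bigcup_(y in [set` s]) ball y (r / 2).

Section upper_doubling.
Context (d : measure_display) (R : realType) (X : measurableMetricType d R).
Variables (mu : {measure set X -> \bar R}).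

(* The values of [lambda] at radii r <= 0 are irrelevant. *)
Definition upper_doubling (lambda : X -> R -> R) : Prop :=
  [/\ (forall x r, 0 < r -> 0 < lambda x r),
      (forall x r s, 0 < r -> r <= s -> lambda x r <= lambda x s),
      (exists C : R, forall x r, 0 < r -> lambda x (2 * r) <= C * lambda x r),
      (forall x r, 0 < r -> (mu (ball x r) <= (lambda x r)%:E)%E) &
      (* this bound for (x, y) and for (y, x) is the two-sided comparability *)
      (exists C : R, forall x y r, 0 < r -> mdist x y <= r ->
         lambda x r <= C * lambda y r)].

End upper_doubling.

Section complex_functions.
Context (d : measure_display) (T : measurableType d) (R : realType).

Definition cmeasurable (D : set T) (f : T -> R[i]) : Prop :=
  measurable_fun D (fun x => complex.Re (f x)) /\ measurable_fun D (fun x => complex.Im (f x)).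

Variable mu : {measure set T -> \bar R}.

Definition cintegral (D : set T) (f : T -> R[i]) : R[i] :=
  (\int[mu]_(x in D) complex.Re (f x)) +i* (\int[mu]_(x in D) complex.Im (f x)).

Definition cLnorm (p : \bar R) (f : T -> R[i]) : \bar R :=
  Lnorm mu p (fun x => (normc (f x))%:E).

Definition cLfun (p : \bar R) (f : T -> R[i]) : Prop :=
  cmeasurable setT f /\ (cLnorm p f < +oo)%E.

End complex_functions.

Section calderon_zygmund.
Context (d : measure_display) (R : realType) (X : measurableMetricType d R).
Variables (mu : {measure set X -> \bar R}).

Definition supp (f : X -> R[i]) : set X := closure [set x | f x != 0].

Definition bounded_supp (f : X -> R[i]) : Prop :=
  exists (x : X) (r : R), supp f `<=` ball x r.

Definition off_diagonal : set (X * X) := [set z | z.1 <> z.2].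

(* Complex, two-variable analogue of the library's [locally_integrable]. *)
Definition L1loc_off_diagonal (K : X -> X -> R[i]) : Prop :=
  cmeasurable off_diagonal (fun z => K z.1 z.2) /\
  forall A : set (X * X), A `<=` off_diagonal -> compact A ->
    (\int[mu \x mu]_(z in A) (normc (K z.1 z.2))%:E < +oo)%E.

(* A kernel lives off the diagonal: K x x is a junk value, so the smoothness
   condition is required only where all the kernel values in it make sense
   (the guard x' <> y matters only when c >= 1). *)
Definition cz_kernel (lambda : X -> R -> R) (K : X -> X -> R[i]) : Prop :=
  L1loc_off_diagonal K /\
  exists C c delta : R,
    [/\ 0 < C, 0 < c, 0 < delta <= 1,
        (forall x y, x <> y ->
           normc (K x y) <= C * Num.min (lambda x (mdist x y))^-1
                                        (lambda y (mdist x y))^-1) &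
        (forall x x' y, x <> y -> x' <> y -> mdist x x' <= c * mdist x y ->
           normc (K x y - K x' y) + normc (K y x - K y x') <=
           C * (mdist x x' `^ delta /
                (mdist x y `^ delta * lambda x (mdist x y))))].

(* Operators act on functions rather than on classes modulo null sets, so the
   identities between elements of L^2 hold almost everywhere. *)
Definition L2_linear (T : (X -> R[i]) -> (X -> R[i])) : Prop :=
  forall (a : R[i]) (f g : X -> R[i]), cLfun mu 2%:E f -> cLfun mu 2%:E g ->
    {ae mu, forall x, T (fun y => a * f y + g y) x = a * T f x + T g x}.

Definition L2_bounded (T : (X -> R[i]) -> (X -> R[i])) : Prop :=
  exists2 B : R, 0 <= B & forall f, cLfun mu 2%:E f ->
    cLfun mu 2%:E (T f) /\ (cLnorm mu 2%:E (T f) <= B%:E * cLnorm mu 2%:E f)%E.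

Definition cz_operator (lambda : X -> R -> R) (K : X -> X -> R[i])
    (T : (X -> R[i]) -> (X -> R[i])) : Prop :=
  [/\ cz_kernel lambda K,
      L2_linear T &
      forall f, cLfun mu +oo%E f -> bounded_supp f ->
        {ae mu, forall x, ~ supp f x ->
           T f x = cintegral mu setT (fun y => K x y * f y)}].

Definition truncated_op (K : X -> X -> R[i]) (eps : R) (f : X -> R[i]) (x : X)
    : R[i] :=
  cintegral mu [set y | eps <= mdist x y] (fun y => K x y * f y).

Definition maximal_op (K : X -> X -> R[i]) (f : X -> R[i]) (x : X) : \bar R :=
  ereal_sup [set (normc (truncated_op K eps f x))%:E | eps in [set e | 0 < e]].

(* The supremum runs over pairs (center, radius).  If mu (rho Q) = 0, the
   average is +oo * 0 = 0, so such balls do not contribute. *)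
Definition maximal_fun (p rho : R) (f : X -> R[i]) (x : X) : \bar R :=
  ereal_sup [set m : \bar R | exists (z : X) (r : R),
    [/\ 0 < r, ball z r x &
      m = (((mu (ball z (rho * r)))^-1 *
            \int[mu]_(y in ball z r) (normc (f y) `^ p)%:E) `^ p^-1)%E]].

End calderon_zygmund.

(* Main.v *)
Require Import Defs.
From mathcomp Require Import all_boot all_order all_algebra.
From mathcomp Require Import all_classical all_reals all_analysis.
From mathcomp Require Import measurable_realfun complex ring lra.

(* Cut at the first scale r = A^k eps at which mu is doubling around x.  Below r
   the ratios mu(B(x, A^j eps)) / lambda(x, A^j eps) decay geometrically, so the
   integral of |K(x, .) f| over eps <= d(x, .) < A r is at most C M_(5)f(x).  If
   f1 is the part of f near x and f2 the rest, then for almost every x' in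
   B(x, r) the smoothness of K gives
     |T_{A r} f(x)| <= |T f2(x')| + C M_(5)f(x)
                    <= |T f(x')| + |T f1(x')| + C M_(5)f(x),
   and x' can be chosen outside the sets where |T f| exceeds C M_{eta,6}(T f)(x)
   (Chebyshev) and |T f1| exceeds C M_(5)f(x) (weak type (1,1)), each of which
   has measure at most mu(B(x, r)) / 4.

   The weak type (1,1) inequality at level t is a Calderon-Zygmund decomposition
   without Lebesgue differentiation: inner approximation replaces {|f| > t} by
   finitely many small disjoint pieces P_i around points x_i, such that the
   balls B(x_i, h) at the smallest scale h stay in a set of measure at most
   C |f|_1 / t.  Let r_i be the last scale at which the mean of |f| around x_i
   exceeds t, and R_i the first doubling ball of larger radius.  The bad part is
   the sum of the f 1_{P_i} - c_i 1_{R_i}, where c_i makes the integral vanish;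
   the sum of the |c_i| 1_{R_i} need not be bounded, but expanding its square and
   ordering the balls by size shows that its L^2 norm squared is at most
   C t |f|_1. *)

Set Implicit Arguments.
Unset Strict Implicit.
Unset Printing Implicit Defensive.
Import Order.TTheory GRing.Theory Num.Theory.
Import numFieldNormedType.Exports.
Import ComplexField.Normc.
Local Open Scope classical_set_scope.
Local Open Scope ring_scope.

(** * Complex moduli and integrals *)

(** The obstacle is that [mu] need not be doubling: only [lambda] is controlled from one scale to
    the next, where it grows by at most a factor L. A scale therefore counts as doubling when the
    mass grows there by at most 2 L. The surplus factor 2 makes mu / lambda halve with each step
    down from the first such scale, so that the sum over the annuli is geometric. In the final
    argument consecutive scales have ratio 5 A with A = max(7, 1/c). The bound A >= 1/c makes the
    smoothness condition available beyond A r; 5 A r is the radius at which M_(5) measures f1, the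
    part of f in B(x, A r); and 6 r <= 5 A r serves M_{eta,6}. One doubling inequality at r thus
    controls both exceptional sets. Additivity of T and its kernel formula hold almost everywhere
    only, so x itself cannot be used: x' is found in a set of positive measure, and T is only ever
    expanded over finite sums. *)

Section complex_modulus.
Context (R : realType).
Implicit Types x y : R[i].
Local Notation Re := complex.Re.
Local Notation Im := complex.Im.

Lemma ReD x y : Re (x + y) = Re x + Re y.
Proof. by case: x y => [a b] [c e]. Qed.

Lemma ImD x y : Im (x + y) = Im x + Im y.
Proof. by case: x y => [a b] [c e]. Qed.

Lemma ReM x y : Re (x * y) = Re x * Re y - Im x * Im y.
Proof. by case: x y => [a b] [c e]. Qed.

Lemma ImM x y : Im (x * y) = Re x * Im y + Im x * Re y.
Proof. by case: x y => [a b] [c e]. Qed.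

Lemma normcE x : normc x = Num.sqrt (Re x ^+ 2 + Im x ^+ 2).
Proof. by case: x. Qed.

Lemma normc_ge0 x : 0 <= normc x.
Proof. by rewrite normcE sqrtr_ge0. Qed.

Lemma normc_real (a : R) : normc (a%:C)%C = `|a|.
Proof. by rewrite normcE /= expr0n /= addr0 sqrtr_sqr. Qed.

Lemma Re_le_normc x : `|Re x| <= normc x.
Proof.
rewrite normcE -[leLHS](ger0_norm (normr_ge0 _)) -sqrtr_sqr ler_sqrt.
  by rewrite real_normK ?num_real// lerDl sqr_ge0.
by rewrite addr_ge0// sqr_ge0.
Qed.

Lemma Im_le_normc x : `|Im x| <= normc x.
Proof.
rewrite normcE -[leLHS](ger0_norm (normr_ge0 _)) -sqrtr_sqr ler_sqrt.
  by rewrite real_normK ?num_real// lerDr sqr_ge0.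
by rewrite addr_ge0// sqr_ge0.
Qed.

Lemma normc_le_ReIm x : normc x <= `|Re x| + `|Im x|.
Proof.
rewrite normcE -[leRHS]ger0_norm ?addr_ge0// -[leRHS]sqrtr_sqr ler_sqrt ?sqr_ge0//.
rewrite sqrrD !real_normK ?num_real// -addrA lerD2l lerDr.
by rewrite mulrn_wge0// mulr_ge0.
Qed.

Lemma normc_distC x y : normc (x - y) = normc (y - x).
Proof. by rewrite -normcN opprB. Qed.

Lemma normc_sum (I : Type) (s : seq I) (P : pred I) (F : I -> R[i]) :
  normc (\sum_(i <- s | P i) F i) <= \sum_(i <- s | P i) normc (F i).
Proof.
elim/big_ind2 : _ => //; first by rewrite normc0.
by move=> ? ? ? ? h1 h2; rewrite (le_trans (le_normcD _ _))// lerD.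
Qed.

End complex_modulus.

Section complex_integral.
Context (d : measure_display) (T : measurableType d) (R : realType).
Variable mu : {measure set T -> \bar R}.
Implicit Types (D : set T) (f g : T -> R[i]).
Local Notation Re := complex.Re.
Local Notation Im := complex.Im.

Lemma cmeasurableS D D' f : measurable D' -> D `<=` D' ->
  cmeasurable D' f -> cmeasurable D f.
Proof. by move=> mD' DD' [h1 h2]; split; apply: measurable_funS DD' _. Qed.

Lemma cmeasurable_cst D (a : R[i]) : cmeasurable D (fun=> a).
Proof. by split; exact: measurable_cst. Qed.

Lemma cmeasurableD D f g : cmeasurable D f -> cmeasurable D g ->
  cmeasurable D (fun x => f x + g x).
Proof.
move=> [f1 f2] [g1 g2]; split.
  by under eq_fun do rewrite ReD; exact: measurable_funD.
by under eq_fun do rewrite ImD; exact: measurable_funD.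
Qed.

Lemma cmeasurableM D f g : cmeasurable D f -> cmeasurable D g ->
  cmeasurable D (fun x => f x * g x).
Proof.
move=> [f1 f2] [g1 g2]; split.
  by under eq_fun do rewrite ReM; apply: measurable_funB; exact: measurable_funM.
by under eq_fun do rewrite ImM; apply: measurable_funD; exact: measurable_funM.
Qed.

Lemma cmeasurable_indic D (A : set T) : measurable A ->
  cmeasurable D (fun x => ((\1_A x : R)%:C)%C).
Proof. by move=> mA; split => /=; [exact: measurable_indic|exact: measurable_cst]. Qed.

Lemma measurable_normc D f : cmeasurable D f -> measurable_fun D (fun x => normc (f x)).
Proof.
move=> [f1 f2].
under eq_fun do rewrite normcE.
apply: (measurableT_comp (continuous_measurable_fun _)) => /=.
  by move=> x; exact: sqrt_continuous.
by apply: measurable_funD; exact: measurable_funX.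
Qed.

Definition cintegrable D f :=
  mu.-integrable D (fun x => (Re (f x))%:E) /\ mu.-integrable D (fun x => (Im (f x))%:E).

Lemma cintegrableP D f : measurable D -> cmeasurable D f ->
  (\int[mu]_(x in D) (normc (f x))%:E < +oo)%E -> cintegrable D f.
Proof.
move=> mD mf foo.
have In : mu.-integrable D (fun x => (normc (f x))%:E).
  apply/integrableP; split.
    by apply/measurable_EFinP; exact: measurable_normc.
  by under eq_integral do rewrite gee0_abs ?lee_fin ?normc_ge0//.
case: (mf) => m1 m2; split.
  apply: le_integrable In => //; first exact/measurable_EFinP.
  by move=> x Dx; rewrite !abse_EFin lee_fin [leRHS]ger0_norm ?normc_ge0 ?Re_le_normc.
apply: le_integrable In => //; first exact/measurable_EFinP.
by move=> x Dx; rewrite !abse_EFin lee_fin [leRHS]ger0_norm ?normc_ge0 ?Im_le_normc.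
Qed.

Lemma cintegrableD D f g : measurable D -> cintegrable D f -> cintegrable D g ->
  cintegrable D (fun x => f x + g x).
Proof.
move=> mD [f1 f2] [g1 g2]; split.
  by apply: eq_integrable (integrableD mD f1 g1) => // x _ /=; rewrite ReD EFinD.
by apply: eq_integrable (integrableD mD f2 g2) => // x _ /=; rewrite ImD EFinD.
Qed.

Lemma cintegrableZ D f (a : R[i]) : measurable D -> cintegrable D f ->
  cintegrable D (fun x => a * f x).
Proof.
move=> mD [f1 f2]; split.
  apply: eq_integrable (integrableB mD (integrableZl mD (Re a) f1) (integrableZl mD (Im a) f2)) => // x _ /=.
  by rewrite ReM EFinB !EFinM.
apply: eq_integrable (integrableD mD (integrableZl mD (Re a) f2) (integrableZl mD (Im a) f1)) => // x _ /=.
by rewrite ImM EFinD !EFinM.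
Qed.

Lemma cintegralD D f g : measurable D -> cintegrable D f -> cintegrable D g ->
  cintegral mu D (fun x => f x + g x) = cintegral mu D f + cintegral mu D g.
Proof.
move=> mD [f1 f2] [g1 g2].
rewrite /cintegral; congr Complex.
  by rewrite -RintegralD//; apply: eq_Rintegral => x _; rewrite ReD.
by rewrite -RintegralD//; apply: eq_Rintegral => x _; rewrite ImD.
Qed.

Lemma cintegralZ D f (a : R[i]) : measurable D -> cintegrable D f ->
  cintegral mu D (fun x => a * f x) = a * cintegral mu D f.
Proof.
move=> mD [f1 f2].
have i1 (b : R) : mu.-integrable D (fun x => (b * Re (f x))%:E).
  by under eq_fun do rewrite EFinM; exact: integrableZl.
have i2 (b : R) : mu.-integrable D (fun x => (b * Im (f x))%:E).
  by under eq_fun do rewrite EFinM; exact: integrableZl.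
have ZR b : \int[mu]_(x in D) (b * Re (f x)) = b * \int[mu]_(x in D) Re (f x).
  exact: RintegralZl.
have ZI b : \int[mu]_(x in D) (b * Im (f x)) = b * \int[mu]_(x in D) Im (f x).
  exact: RintegralZl.
rewrite /cintegral; case: a => a b /=.
apply/eqP; rewrite eq_complex /=; apply/andP; split; apply/eqP.
  transitivity (\int[mu]_(x in D) (a * Re (f x) - b * Im (f x))).
    by apply: eq_Rintegral => x _; rewrite ReM.
  by rewrite -ZR -ZI; exact: (RintegralB mD (i1 a) (i2 b)).
transitivity (\int[mu]_(x in D) (a * Im (f x) + b * Re (f x))).
  by apply: eq_Rintegral => x _; rewrite ImM.
by rewrite -ZR -ZI; exact: (RintegralD mD (i2 a) (i1 b)).
Qed.

(** The real and imaginary parts are bounded separately by the integral of the modulus. The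
    resulting factor 2 instead of 1 is harmless, and it is the source of many factors 2 in the
    constants below. *)
Lemma normc_cintegral_le D f : measurable D -> cmeasurable D f ->
  ((normc (cintegral mu D f))%:E <= 2%:E * \int[mu]_(x in D) (normc (f x))%:E)%E.
Proof.
move=> mD mf; case: (mf) => m1 m2.
have mn : measurable_fun D (fun x => (normc (f x))%:E : \bar R).
  by apply/measurable_EFinP; exact: measurable_normc.
(* [fine] sends infinite values to 0, so the bound also covers divergent integrals. *)
have fl (x : \bar R) : (`|fine x|%:E <= `|x|)%E.
  by case: x => //= [|]; rewrite normr0 leey.
have aux (h : T -> R) : measurable_fun D h -> (forall x, `|h x| <= normc (f x)) ->
    (`|\int[mu]_(x in D) h x|%:E <= \int[mu]_(x in D) (normc (f x))%:E)%E.
  move=> mh hf; apply: (le_trans (fl _)).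
  apply: (le_trans (le_abse_integral _ _ _)) => //; first exact/measurable_EFinP.
  apply: ge0_le_integral => //; first by apply/measurable_EFinP/measurableT_comp.
  by move=> x _; rewrite lee_fin.
apply: (le_trans (y := (`|\int[mu]_(x in D) Re (f x)|%:E + `|\int[mu]_(x in D) Im (f x)|%:E)%E)).
  by rewrite -EFinD lee_fin; exact: normc_le_ReIm.
have -> : 2%:E = (1%:E + 1%:E)%E :> \bar R by rewrite -EFinD.
rewrite ge0_muleDl// !mul1e leeD//; apply: aux => // x.
  exact: Re_le_normc.
exact: Im_le_normc.
Qed.

(** If D has infinite measure both sides are 0, since [fine] of an infinite value is 0. *)
Lemma cintegralC D (a : R[i]) : measurable D ->
  cintegral mu D (fun=> a) = a * ((fine (mu D))%:C)%C.
Proof.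
move=> mD; rewrite /cintegral !Rintegral_cst//; case: a => a b /=.
by apply/eqP; rewrite eq_complex /= !mulr0 subr0 add0r !eqxx.
Qed.

Lemma cintegral_mkcond D f : (forall x, ~ D x -> f x = 0) ->
  cintegral mu setT f = cintegral mu D f.
Proof.
move=> f0; rewrite /cintegral; congr Complex.
  rewrite [RHS]Rintegral_mkcond; apply: eq_Rintegral => x _; rewrite patchE.
  by case: (boolP (x \in D)) => //; rewrite notin_setE => /f0 ->.
rewrite [RHS]Rintegral_mkcond; apply: eq_Rintegral => x _; rewrite patchE.
by case: (boolP (x \in D)) => //; rewrite notin_setE => /f0 ->.
Qed.

Lemma cintegral_setU A B f : measurable A -> measurable B -> [disjoint A & B] ->
  cintegrable (A `|` B) f ->
  cintegral mu (A `|` B) f = cintegral mu A f + cintegral mu B f.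
Proof.
by move=> mA mB AB [f1 f2]; rewrite /cintegral !Rintegral_setU//.
Qed.

Lemma eq_cintegral D f g : {in D, f =1 g} -> cintegral mu D f = cintegral mu D g.
Proof.
by move=> fg; rewrite /cintegral; congr Complex; apply: eq_Rintegral => x xD; rewrite fg.
Qed.

(** Puts the operator bound in the form without roots that Chebyshev's inequality and the expansion
    of a square use. *)
Lemma cLnorm2_le (B : R) f g : 0 <= B -> (cLnorm mu 2%:E f <= B%:E * cLnorm mu 2%:E g)%E ->
  (\int[mu]_x (normc (f x) ^+ 2)%:E <= (B ^+ 2)%:E * \int[mu]_x (normc (g x) ^+ 2)%:E)%E.
Proof.
move=> B0 H.
have E h : (\int[mu]_x (normc (h x) ^+ 2)%:E = cLnorm mu 2%:E h `^ 2)%E.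
  rewrite /cLnorm poweR_Lnorm//; apply: eq_integral => x _ /=.
  by rewrite ger0_norm ?normc_ge0// powR_mulrn// normc_ge0.
rewrite !E.
apply: (@le_trans _ _ ((B%:E * cLnorm mu 2%:E g) `^ 2)%E).
  by apply: gt0_ler_poweR => //; rewrite in_itv/= ?andbT ?leey ?Lnorm_ge0// mule_ge0// Lnorm_ge0.
by rewrite poweRM// ?Lnorm_ge0// poweR_EFin powR_mulrn.
Qed.

Lemma cLnorm2_lty f :
  (\int[mu]_x (normc (f x) ^+ 2)%:E < +oo)%E -> (cLnorm mu 2%:E f < +oo)%E.
Proof.
move=> H; rewrite /cLnorm unlock.
apply: poweR_lty.
under eq_integral.
  move=> x _; rewrite abse_EFin poweR_EFin ger0_norm ?normc_ge0// powR_mulrn ?normc_ge0//.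
  over.
exact: H.
Qed.

Lemma cLnormy_lty f (M : R) : (forall x, normc (f x) <= M) -> (cLnorm mu +oo%E f < +oo)%E.
Proof.
move=> fM; rewrite /cLnorm unlock; case: ifP => // _.
apply: (@le_lt_trans _ _ M%:E); last by rewrite ltry.
apply: ereal_inf_lbound; apply: aeW => x /=.
by rewrite lee_fin ger0_norm ?normc_ge0.
Qed.

End complex_integral.

(** * Borel measures on geometrically doubling spaces *)

Lemma near_lt_cvg (R : realType) (u : nat -> \bar R) (l a : \bar R) :
  u n @[n --> \oo] --> l -> (l < a)%E -> \forall n \near \oo, (u n < a)%E.
Proof.
move=> ul la; apply: (ul [set y | (y < a)%E]); apply: open_nbhs_nbhs; split => //.
exact: open_ereal_lt_ereal.
Qed.

Section measure_monotone.
Context (d : measure_display) (T : measurableType d) (R : realType).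
Variable mu : {measure set T -> \bar R}.

Lemma measure_le (A B : set T) : measurable A -> measurable B -> A `<=` B -> (mu A <= mu B)%E.
Proof. by move=> mA mB AB; apply: le_measure; rewrite ?inE. Qed.

End measure_monotone.

Section metric_measure.
Context (d : measure_display) (R : realType) (X : measurableMetricType d R).
Hypothesis bX : borel_space X.

Lemma ballP (x y : X) (r : R) : ball x r y <-> mdist x y < r.
Proof. by rewrite ballEmdist. Qed.

Lemma mdist_lt_trans (x y z : X) (a b : R) : mdist x y < a -> mdist y z < b ->
  mdist x z < a + b.
Proof. by move=> h1 h2; apply: (le_lt_trans (metric_triangle x y z)); exact: ltrD. Qed.

Lemma open_ball (x : X) (r : R) : open (ball x r).
Proof.
rewrite openE => y /ballP xy; apply/nbhs_ballP; exists (r - mdist x y) => /=.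
  by rewrite subr_gt0.
by move=> z /ballP yz; apply/ballP; rewrite -(subrK (mdist x y) r) addrC;
  apply: le_lt_trans (metric_triangle x y z) _; rewrite ltrD2l.
Qed.

Lemma measurable_open (U : set X) : open U -> measurable U.
Proof. by move=> oU; rewrite bX; exact: sub_sigma_algebra. Qed.

Lemma measurable_mball (x : X) (r : R) : measurable (ball x r).
Proof. exact/measurable_open/open_ball. Qed.

Lemma setC_mball (x : X) (r : R) : ~` ball x r = [set y | r <= mdist x y].
Proof. by apply/seteqP; split=> y /=; rewrite ballEmdist /= leNgt => /negP. Qed.

Lemma measurable_mdist_ge (x : X) (r : R) : measurable [set y | r <= mdist x y].
Proof. by rewrite -setC_mball; exact/measurableC/measurable_mball. Qed.

(** The open e-neighbourhood of F; as a union of balls it is open, hence measurable, for every F. *)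
Definition thicken (e : R) (F : set X) := \bigcup_(y in F) ball y e.

Lemma open_thicken e F : open (thicken e F).
Proof. by apply: bigcup_open => y _; exact: open_ball. Qed.

Lemma measurable_thicken e F : measurable (thicken e F).
Proof. exact/measurable_open/open_thicken. Qed.

Lemma thickenCP e (U : set X) x : ~ thicken e (~` U) x <-> ball x e `<=` U.
Proof.
split=> [h y xy|h [y Uy /ball_sym /h]//].
by apply: contrapT => Uy; apply: h; exists y => //; exact: ball_sym.
Qed.

Variable mu : {measure set X -> \bar R}.

(** Every point of the open set U has a ball inside U, so the parts of A within 1 / (n + 1) of the
    complement of U decrease to the empty set. Finiteness of [mu A] then allows continuity from
    above. *)
Lemma measure_thickenC_small (A U : set X) (e : R) : measurable A -> (mu A < +oo)%E ->
  open U -> A `<=` U -> 0 < e ->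
  exists2 h : R, 0 < h & (mu (A `&` thicken h (~` U)) < e%:E)%E.
Proof.
move=> mA Afin oU AU e0.
pose F n := A `&` thicken n.+1%:R^-1 (~` U).
have mF n : measurable (F n) by apply: measurableI => //; exact: measurable_thicken.
have capF : \bigcap_n F n = set0.
  apply/seteqP; split => // x Fx; have [Ax _] := Fx 0%N I.
  have := oU; rewrite openE => /(_ x (AU _ Ax)) /nbhs_ballP [r /= r0 rU].
  have [n nr] : exists n, n.+1%:R^-1 < r :> R.
    exists (Num.truncn r^-1); rewrite invf_plt ?posrE//; exact: truncnS_gt.
  have [_] := Fx n I; apply/(thickenCP _ _ _).2/(subset_trans _ rU).
  exact/le_ball/ltW.
have cv : mu (F n) @[n --> \oo] --> 0%E.
  rewrite -(measure0 mu) -capF; apply: (@nonincreasing_cvg_mu _ _ _ mu F) => //.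
  - by apply: le_lt_trans Afin; apply: le_measure; rewrite ?inE//; apply: subIsetl.
  - by rewrite capF.
  - move=> n m nm; apply/subsetPset; apply: setIS => x [y Uy yx]; exists y => //.
    by apply: le_ball yx; rewrite lef_pV2 ?posrE// ler_nat.
have [|N _ /(_ N (leqnn _)) ?] := near_lt_cvg cv (_ : 0%E < e%:E)%E; first by rewrite lte_fin.
by exists N.+1%:R^-1.
Qed.

(** The sets with this approximation property for every e form a sigma-algebra that contains the
    open sets, hence all Borel sets. Errors are measured inside a set B of finite measure, which
    keeps continuity from above available although [mu] may be infinite. *)
Lemma closed_open_approx (B : set X) (A : set X) (e : R) : measurable B -> open B -> (mu B < +oo)%E ->
  measurable A -> 0 < e ->
  exists F U : set X, [/\ closed F, open U, F `<=` A, A `<=` U &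
    (mu (B `&` (U `\` F)) < e%:E)%E].
Proof.
move=> mB oB Bfin mA; move: e.
pose C : set (set X) := [set A | forall e : R, 0 < e -> exists F U : set X,
  [/\ closed F, open U, F `<=` A, A `<=` U &
    (mu (B `&` (U `\` F)) < e%:E)%E]].
suff : measurable `<=` C by exact.
rewrite bX; apply: smallest_sub; last first.
  move=> U oU e e0.
  have [] := @measure_thickenC_small (B `&` U) U e _ _ oU _ e0.
  - by apply: measurableI => //; exact: measurable_open.
  - apply: le_lt_trans Bfin; apply: measure_le => //.
    by apply: measurableI => //; exact: measurable_open.
  - exact: subIsetr.
  - move=> h h0 small; exists (~` thicken h (~` U)), U; split => //.
    + exact/open_closedC/open_thicken.
    + by move=> x /thickenCP; apply; exact: ballxx.
    + by rewrite setDE setCK setIA.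
split.
- move=> e e0; exists set0, set0; split=> //; [exact: closed0|exact: open0|].
  by rewrite set0D setI0 measure0 lte_fin.
- move=> {mA}A CA e e0; have [F [U [cF oU FA AU small]]] := CA e e0.
  exists (~` U), (~` F); split.
  + exact: open_closedC.
  + by rewrite openC.
  + by move=> x Ux; split => // /AU.
  + by move=> x [_ Ax] /FA.
  + by rewrite setDE setCK setIC [X in X `&` _]setIC -setDE [X in mu X]setIC.
move=> {mA}A CA e e0.
have /choice [FU HFU] n : exists FU : set X * set X, [/\ closed FU.1, open FU.2, FU.1 `<=` A n, A n
  `<=` FU.2 &
    (mu (B `&` (FU.2 `\` FU.1)) < (e / 2 / (2 ^ n.+1)%:R)%:E)%E].
  have [F [U H]] := CA n (e / 2 / (2 ^ n.+1)%:R) ltac:(rewrite !divr_gt0// ltr0n expn_gt0//).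
  by exists (F, U).
(* An infinite union of closed sets need not be closed, so the inner set stops at N; the error [G N]
   drops below e by continuity from above. *)
pose F N := \bigcup_(n in `I_N) (FU n).1.
pose U := \bigcup_n (FU n).2.
have oU : open U by apply: bigcup_open => n _; case: (HFU n).
have mFn n : measurable (FU n).1.
  by have [cF _ _ _ _] := HFU n; rewrite -[X in measurable X]setCK;
    apply/measurableC/measurable_open; rewrite openC.
have mUn n : measurable (FU n).2 by have [_ oUn _ _ _] := HFU n; exact: measurable_open.
have mF N : measurable (F N) by apply: bigcup_measurable => n _; exact: mFn.
have mU : measurable U by exact: measurable_open.
pose G N := B `&` (U `\` F N).
have mG N : measurable (G N) by apply: measurableI => //; exact: measurableD.
have capG : \bigcap_N G N `<=` \bigcup_n (B `&` ((FU n).2 `\` (FU n).1)).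
  move=> x Gx; have [Bx [[n _ Unx] _]] := Gx 0%N I; exists n => //; split=> //; split=> // Fnx.
  by have [_ [_]] := Gx n.+1 I; apply; exists n => /=.
have mcap : measurable (\bigcap_N G N) by exact: bigcap_measurable.
have bound : (mu (\bigcap_N G N) < e%:E)%E.
  apply: (@le_lt_trans _ _ (e / 2)%:E); last by rewrite lte_fin ltr_pdivrMr// ltr_pMr// ltr1n.
  apply: le_trans (epsilon_trick0 predT _); last by rewrite divr_ge0// ltW.
  apply: (le_trans (measure_sigma_subadditive _ _ mcap capG)) => [n|].
    by apply: measurableI => //; apply: measurableD; [exact: mUn|exact: mFn].
  by apply: lee_nneseries => n _ //; apply: ltW; have [] := HFU n.
have cv : mu (G N) @[N --> \oo] --> mu (\bigcap_N G N).
  apply: (@nonincreasing_cvg_mu _ _ _ mu G) => //.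
  - by apply: le_lt_trans Bfin; apply: measure_le => // x [].
  - move=> n m nm; apply/subsetPset => x [Bx [Ux Fx]]; split => //; split => // Fnx; apply: Fx.
    by case: Fnx => k /= kn Fk; exists k => //=; exact: leq_trans nm.
have [N _ /(_ N (leqnn _)) GN] := near_lt_cvg cv bound.
exists (F N), U; split => //.
- by rewrite /F bigcup_mkord; apply: closed_bigsetU => n _; case: (HFU n).
- by move=> x [n _ Fx]; exists n => //; have [_ _ + _ _] := HFU n; apply.
- by move=> x [n _ Ax]; exists n => //; have [_ _ _ + _] := HFU n; apply.
Qed.

Hypothesis gd : geometrically_doubling X.

(** Halving iterated n times. Only the finiteness of the cover is recorded, not its cardinality. *)
Lemma doubling_cover (n : nat) (x : X) (r : R) : 0 < r ->
  exists s : seq X, ball x r `<=` \bigcup_(y in [set` s]) ball y (r / 2 ^+ n).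
Proof.
have [N HN] := gd; move=> r0; elim: n => [|n [s Hs]].
  by exists [:: x] => y xy; exists x; rewrite /= ?inE// expr0 divr1.
have rn0 : 0 < r / 2 ^+ n by rewrite divr_gt0// exprn_gt0.
have /choice [F HF] y : exists t : seq X,
    ball y (r / 2 ^+ n) `<=` \bigcup_(z in [set` t]) ball z (r / 2 ^+ n.+1).
  by have [t [_ Ht]] := HN y _ rn0; exists t; rewrite exprSr invfM mulrA.
exists (flatten [seq F y | y <- s]) => y /Hs[z /= zs /HF[w /= wF wy]].
by exists w => //=; apply/flattenP; exists (F z) => //; exact: map_f.
Qed.

Lemma bounded_cover (x : X) (r e : R) : 0 < e ->
  exists s : seq X, ball x r `<=` \bigcup_(y in [set` s]) ball y e.
Proof.
move=> e0; have r1 : 0 < Num.max r 1 by rewrite lt_max ltr01 orbT.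
have [n rn] : exists n : nat, Num.max r 1 / e <= 2 ^+ n.
  exists (Num.truncn (Num.max r 1 / e)).+1; apply: ltW.
  apply: (lt_le_trans (truncnS_gt _)); rewrite -natrX ler_nat; apply: ltnW; exact: ltn_expl.
have [s Hs] := doubling_cover n x r1; exists s => y xy.
have [|z zs zy] := Hs y; first by apply: le_ball xy; rewrite le_max lexx.
exists z => //; apply: le_ball zy.
by rewrite ler_pdivrMr ?exprn_gt0// mulrC -ler_pdivrMr.
Qed.

(** [X * X] carries the product sigma-algebra, for which openness alone does not give measurability.
    The countable covers supplied by geometric doubling exhibit the off-diagonal as a countable
    union of measurable rectangles. Measurability of the sections of K rests on this. *)
Lemma measurable_off_diagonal : measurable (@off_diagonal d R X).
Proof.
have /choice [s Hs] n : exists s : seq X, ball (point : X) n.+1%:R `<=`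
    \bigcup_(y in [set` s]) ball y (n.+1%:R^-1).
  exact: bounded_cover.
have -> : @off_diagonal d R X = \bigcup_n \bigcup_(y in [set` s n])
    (ball y (n.+1%:R^-1) `*` ~` ball y (n.+1%:R^-1)).
  apply/seteqP; split => [[x z] /= xz|[x z] [n _ [y _ /= [yx nyz]]] xz]; last first.
    by move: xz yx nyz => /= ->.
  have xz0 : 0 < mdist x z by rewrite mdist_gt0; apply/eqP.
  (* With n the integer part of e, n + 1 > e puts x in the ball about [point] and makes 2 / (n + 1)
     smaller than the distance from x to z, so no ball of radius 1 / (n + 1) contains both. *)
  pose e := Num.max (mdist point x) (2 / mdist x z).
  have en : e < (Num.truncn e).+1%:R by exact: truncnS_gt.
  have [|y ys yx] := Hs (Num.truncn e) x.
    by apply/ballP; apply: le_lt_trans en; rewrite le_max lexx.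
  exists (Num.truncn e) => //; exists y => //; split => //= yz.
  have := mdist_lt_trans ((ballP _ _ _).1 (ball_sym yx)) ((ballP _ _ _).1 yz).
  apply/negP; rewrite -leNgt -mulr2n -[leLHS]mulr_natl ler_pdivrMr// mulrC -ler_pdivrMr//.
  by apply: ltW; apply: le_lt_trans en; rewrite le_max lexx orbT.
apply: bigcup_measurable => n _; apply: fin_bigcup_measurable => // y _.
by apply: measurableX; [exact: measurable_mball|exact/measurableC/measurable_mball].
Qed.

(** The intersections of A with the covering balls are peeled off one after the other. Null
    intersections are thrown away, so each kept piece has positive measure and can be recentred at
    one of its own points. *)
Lemma disjoint_pieces (s : seq X) (e : R) (A : set X) : measurable A ->
  A `<=` \bigcup_(y in [set` s]) ball y e ->
  exists l : seq (X * set X), [/\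
    (forall i : 'I_(size l), let p := tnth (in_tuple l) i in
      [/\ measurable p.2, p.2 p.1, (0 < mu p.2)%E, p.2 `<=` ball p.1 (e + e) & p.2 `<=` A]),
    (forall i j : 'I_(size l), i != j ->
       (tnth (in_tuple l) i).2 `&` (tnth (in_tuple l) j).2 = set0) &
    mu (A `\` \bigcup_(i in [set: 'I_(size l)]) (tnth (in_tuple l) i).2) = 0%E].
Proof.
elim: s A => [|y s IH] A mA As.
  exists [::]; split => [[]//|[]//|].
  rewrite [X in mu X](_ : _ = set0) ?measure0//; apply/seteqP; split => // x [Ax _].
  by have [? //] := As _ Ax.
have mB : measurable (A `&` ball y e) by apply: measurableI => //; exact: measurable_mball.
have mD : measurable (A `\` ball y e) by apply: measurableD => //; exact: measurable_mball.
have [l [Hl Dl ml]] : exists l : seq (X * set X), [/\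
    (forall i : 'I_(size l), let p := tnth (in_tuple l) i in
      [/\ measurable p.2, p.2 p.1, (0 < mu p.2)%E, p.2 `<=` ball p.1 (e + e) & p.2 `<=` A `\` ball y e]),
    (forall i j : 'I_(size l), i != j ->
       (tnth (in_tuple l) i).2 `&` (tnth (in_tuple l) j).2 = set0) &
    mu ((A `\` ball y e) `\` \bigcup_(i in [set: 'I_(size l)]) (tnth (in_tuple l) i).2) = 0%E].
  apply: IH => // x [Ax yx]; have [z /= + zx] := As _ Ax.
  by rewrite in_cons => /predU1P[zy|zs]; [rewrite zy in zx|exists z].
have mU : measurable (\bigcup_(i in [set: 'I_(size l)]) (tnth (in_tuple l) i).2).
  by apply: fin_bigcup_measurable => // i _; have [] := Hl i.
have [m0|m0] := eqVneq (mu (A `&` ball y e)) 0%E.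
  exists l; split => //.
    by move=> i p; have [h1 h2 h3 h4 h5] := Hl i; split=> // x /h5 [].
  apply/eqP; rewrite eq_le measure_ge0 andbT.
  apply: (@le_trans _ _ (mu (A `&` ball y e) + mu ((A `\` ball y e) `\` \bigcup_(i in [set:
    'I_(size l)]) (tnth (in_tuple l) i).2))%E); last by rewrite m0 ml adde0.
  apply: (le_trans _ (measureU2 _ _ _)) => //; last exact: measurableD.
  apply: measure_le; [exact: measurableD|apply: measurableU => //; exact: measurableD|].
  by move=> x [Ax Ux]; have [yx|yx] := pselect (ball y e x); [left|right].
have [x [Ax yx]] : exists x, (A `&` ball y e) x.
  by apply/set0P; apply: contra_neq m0 => ->; rewrite measure0.
pose l' := (x, A `&` ball y e) :: l.
have t0 : tnth (in_tuple l') ord0 = (x, A `&` ball y e) by [].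
have tS i : tnth (in_tuple l') (lift ord0 i) = tnth (in_tuple l) i.
  by rewrite !(tnth_nth (x, set0)).
exists l'; split => [i|i j ij|].
- case: (unliftP ord0 i) => [j|] ->.
    by rewrite tS; have [h1 h2 h3 h4 h5] := Hl j; split=> // z /h5 [].
  rewrite t0 /=; split => //; first by rewrite lt0e m0 measure_ge0.
  by move=> z [Az yz]; exact: ball_triangle (ball_sym yx) yz.
- move: ij; case: (unliftP ord0 i) => [i'|] ->; case: (unliftP ord0 j) => [j'|] ->.
  + by move=> ij; rewrite !tS; apply: Dl; apply: contra_neq ij => ->.
  + move=> _; rewrite t0 tS /=; have [_ _ _ _ h5] := Hl i'.
    by apply/seteqP; split => // z [/h5 [_ ?] []].
  + move=> _; rewrite t0 tS /=; have [_ _ _ _ h5] := Hl j'.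
    by apply/seteqP; split => // z [[_ ?] /h5 []].
  + by rewrite eqxx.
rewrite [X in mu X](_ : _ = (A `\` ball y e) `\` \bigcup_(i in [set: 'I_(size l)]) (tnth (in_tuple
  l) i).2) //.
apply/seteqP; split => z.
  move=> [Az Uz]; split.
    by split => // yz; apply: Uz; exists ord0 => //; rewrite t0.
  by move=> [i _ ?]; apply: Uz; exists (lift ord0 i) => //; rewrite tS.
move=> [[Az yz] Uz]; split => // -[i _]; case: (unliftP ord0 i) => [j|] ->.
  by rewrite tS => ?; apply: Uz; exists j.
by rewrite t0 /= => -[].
Qed.

(* The radius h is uniform over all pieces, while the neighbourhoods B(x_i, h)
   stay inside an open set that is hardly larger than A. *)
Lemma small_pieces (x0 : X) (r a e : R) (A : set X) : measurable A ->
  A `<=` ball x0 r -> (mu (ball x0 r) < +oo)%E -> 1 <= a -> 0 < e ->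
  exists (n : nat) (x : 'I_n -> X) (P : 'I_n -> set X) (h : R) (U : set X),
  [/\ 0 < h, measurable U, (mu U <= mu A + e%:E)%E,
    (forall i, [/\ measurable (P i), P i (x i), (0 < mu (P i))%E,
       P i `<=` ball (x i) (h / a) & P i `<=` A]) &
    [/\ forall i j, i != j -> P i `&` P j = set0,
     forall i, ball (x i) h `<=` U &
     (mu (A `\` \bigcup_(i in [set: 'I_n]) P i) < e%:E)%E]].
Proof.
move=> mA AB Bfin a1 e0.
have mB := measurable_mball x0 r.
have Afin : (mu A < +oo)%E by apply: le_lt_trans Bfin; exact: measure_le.
have [F [U [cF oU FA AU small]]] := closed_open_approx mB (open_ball x0 r) Bfin mA e0.
pose V := ball x0 r `&` U.
have oV : open V by apply: openI => //; exact: open_ball.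
have mV : measurable V by exact: measurable_open.
have AV : A `<=` V by move=> x Ax; split; [exact: AB|exact: AU].
have [h h0 hs] := measure_thickenC_small mA Afin oV AV e0.
pose A' := A `\` thicken h (~` V).
have mA' : measurable A' by apply: measurableD => //; exact: measurable_thicken.
(* Half of h / a, because recentring a piece at one of its own points doubles the radius. *)
have [s Hs] := bounded_cover x0 r (divr_gt0 h0 (mulr_gt0 (ltr0n R 2) (lt_le_trans ltr01 a1))).
have [l [Hl Dl ml]] := disjoint_pieces mA' (subset_trans (fun x (p : A' x) => AB x p.1) Hs).
exists (size l), (fun i => (tnth (in_tuple l) i).1), (fun i => (tnth (in_tuple l) i).2), h, V.
split => //.
- apply: (@le_trans _ _ (mu (A `|` (ball x0 r `&` (U `\` F))))).
    have mF : measurable F.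
      by rewrite -[X in measurable X]setCK; apply/measurableC/measurable_open; rewrite openC.
    apply: measure_le => //.
      by apply: measurableU => //; apply: measurableI => //; apply: measurableD => //; exact: measurable_open.
    by move=> x [Bx Ux]; have [Fx|Fx] := pselect (F x); [left; exact: FA|right].
  have mF : measurable F.
    by rewrite -[X in measurable X]setCK; apply/measurableC/measurable_open; rewrite openC.
  apply: (le_trans (measureU2 _ _ _)) => //.
    by apply: measurableI => //; apply: measurableD => //; exact: measurable_open.
  by rewrite leeD2l// ltW.
- move=> i; have [h1 h2 h3 h4 h5] := Hl i; split => //; last by move=> x /h5 [].
  by move=> x /h4; congr (ball _ _ _); field; rewrite gt_eqF//; exact: lt_le_trans a1.
split => //.
- by move=> i; have [h1 h2 h3 h4 h5] := Hl i; have [_ /thickenCP] := h5 _ h2.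
have mU' : measurable (\bigcup_(i in [set: 'I_(size l)]) (tnth (in_tuple l) i).2).
  by apply: fin_bigcup_measurable => // i _; have [] := Hl i.
apply: le_lt_trans hs.
rewrite -[leRHS]adde0 -[X in (_ + X)%E]ml.
apply: (le_trans _ (measureU2 _ _ _)); last 2 first.
  by apply: measurableI => //; exact: measurable_thicken.
  exact: measurableD.
apply: measure_le; first exact: measurableD.
  apply: measurableU; last exact: measurableD.
  by apply: measurableI => //; exact: measurable_thicken.
by move=> x [Ax Ux]; have [tx|tx] := pselect (thicken h (~` V) x); [left|right].
Qed.

End metric_measure.

(** * Upper doubling measures *)

Lemma exprn_unbounded (R : realType) (a A : R) : 1 < A -> exists n, a < A ^+ n.
Proof.
move=> A1; have B n : 1 + (A - 1) *+ n <= A ^+ n.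
  elim: n => [|n IH]; first by rewrite mulr0n addr0 expr0.
  have : 1 <= A ^+ n by rewrite exprn_ege1// ltW.
  rewrite exprS mulrS -mulr_natr in IH *; move: IH; set p := A ^+ n; set q := _ * n%:R.
  nra.
exists (Num.truncn (a / (A - 1))).+1; apply: lt_le_trans (B _).
rewrite -mulr_natr -ltrBlDl mulrC; apply: (@lt_trans _ _ a); first by rewrite ltrBlDl ltrDr.
by rewrite -ltr_pdivrMr ?subr_gt0// truncnS_gt.
Qed.

(** Without a doubling scale, m would grow like (2 L)^n against L^n for l, contradicting m <= l. Let
    k be the first doubling scale. From j + 2 to k, m gains (2 L)^(k-j-2), while from j to k, l
    gains at most L^(k-j); the quotient is 4 L^2 / 2^(k-j). The mass is taken two scales above l
    because the annulus between scales j and j + 1 will be measured in a ball enlarged once more.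
    The bound 1 <= k puts the doubling scale strictly after the initial one. *)
Lemma doubling_index (R : realType) (m l : nat -> R) (L : R) : 1 <= L ->
  (forall j, 0 <= m j) -> (forall j, m j <= l j) -> (forall j, m j <= m j.+1) ->
  (forall j, l j.+1 <= L * l j) -> (exists j, 0 < m j) ->
  exists k, [/\ (1 <= k)%N, 0 < m k, m k.+1 <= 2 * L * m k &
    forall j, (j <= k)%N -> m j.+2 <= 4 * L ^+ 2 / 2 ^+ (k - j) * l j].
Proof.
move=> L1 m0 ml m_incr lL [j0 mj0].
have L0 : 0 < L by exact: lt_le_trans L1.
have l0 j : 0 <= l j by exact: le_trans (m0 j) (ml j).
have lLn n j : l (j + n)%N <= L ^+ n * l j.
  elim: n => [|n IH]; first by rewrite addn0 expr0 mul1r.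
  rewrite addnS (le_trans (lL _))// exprS -mulrA ler_pM2l//.
have growth a n : (forall i, (a <= i < a + n)%N -> 2 * L * m i <= m i.+1) ->
    (2 * L) ^+ n * m a <= m (a + n)%N.
  elim: n => [|n IH] H; first by rewrite addn0 expr0 mul1r.
  rewrite addnS exprS -mulrA; apply: le_trans (H _ _); last by rewrite leq_addr addnS leqnn.
  rewrite ler_pM2l ?mulr_gt0//; apply: IH => i /andP[ai ian]; apply: H.
  by rewrite ai addnS ltnS ltnW.
have ex : exists k, [&& (1 <= k)%N, 0 < m k & m k.+1 <= 2 * L * m k].
  apply: contrapT => /forallNP nex.
  have pos i : 0 < m (j0.+1 + i)%N.
    elim: i => [|i IH]; first by rewrite addn0; exact: lt_le_trans (m_incr _).
    by rewrite addnS; exact: lt_le_trans (m_incr _).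
  have dbl i : (j0.+1 <= i)%N -> 2 * L * m i <= m i.+1.
    move=> ji; rewrite leNgt; apply/negP => lt.
    have := nex i; apply; apply/and3P; split; [exact: leq_trans ji| |exact: ltW].
    by have := pos (i - j0.+1)%N; rewrite subnKC.
  have [n nl] : exists n : nat, l j0.+1 / m j0.+1 < n%:R.
    by exists (Num.truncn (l j0.+1 / m j0.+1)).+1; exact: truncnS_gt.
  have h1 : (2 * L) ^+ n * m j0.+1 <= L ^+ n * l j0.+1.
    apply: le_trans (lLn _ _); apply: le_trans (ml _); apply: growth => i /andP[ji _].
    exact: dbl.
  move: h1; rewrite exprMn [2 ^+ n * _]mulrC -mulrA ler_pM2l ?exprn_gt0//.
  apply/negP; rewrite -ltNge; have := pos 0%N; rewrite addn0 => p0.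
  rewrite -ltr_pdivrMr//; apply: (lt_trans nl); rewrite -natrX ltr_nat; exact: ltn_expl.
have := ex_minnP ex; case=> k /and3P[k1 mk0 mk] kmin.
have dbl i : (1 <= i < k)%N -> 2 * L * m i <= m i.+1.
  move=> /andP[i1 ik]; rewrite leNgt; apply/negP => lt.
  (* Minimality of k says nothing about a scale of mass zero, but growth is trivial there. *)
  have [mi0|mi0] := ltP 0 (m i).
    have := kmin i; rewrite i1 mi0 (ltW lt) => /(_ isT); by rewrite leqNgt ik.
  have : 2 * L * m i <= m i.+1.
    by rewrite (le_trans _ (m0 _))// mulr_ge0_le0// mulr_ge0// ltW.
  by rewrite leNgt lt.
exists k; split => // j jk.
(* For the last two values of j there is no growth to exploit; m <= l and two steps of l suffice. *)
have [->|jk'] := eqVneq j k.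
  rewrite subnn expr0 divr1 (le_trans (ml _))// (le_trans (lL _))//.
  rewrite (le_trans (ler_wpM2l (ltW L0) (lL _)))// mulrA -expr2 ler_wpM2r//.
  by rewrite ler_peMl ?sqr_ge0// ler1n.
have [kj|kj] := eqVneq k j.+1.
  rewrite kj subSnn expr1 (le_trans (ml _))// (le_trans (lL _))//.
  rewrite (le_trans (ler_wpM2l (ltW L0) (lL _)))// mulrA -expr2 ler_wpM2r//.
  by rewrite ler_pdivlMr// mulrC ler_wpM2r ?sqr_ge0// ler_nat.
have jk2 : (j.+2 <= k)%N by rewrite ltn_neqAle eq_sym kj ltn_neqAle jk' jk.
have [n kn] : exists n, k = (j.+2 + n)%N by exists (k - j.+2)%N; rewrite subnKC.
have h : (2 * L) ^+ n * m j.+2 <= L ^+ n.+2 * l j.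
  apply: (@le_trans _ _ (m k)).
    rewrite kn; apply: growth => i /andP[ji ik]; apply: dbl; rewrite (leq_trans _ ji)//= kn//.
  apply: (le_trans (ml _)); rewrite kn.
  by have := lLn n.+2 j; rewrite !addnS !addSn.
have -> : (k - j = n.+2)%N by rewrite kn -addn2 -addnA addKn addnC addn2.
rewrite -(ler_pM2l (_ : 0 < (2 * L) ^+ n)) ?exprn_gt0 ?mulr_gt0//.
apply: (le_trans h); rewrite le_eqVlt; apply/orP; left; apply/eqP.
rewrite !exprS exprMn; field.
by rewrite expf_neq0//= pnatr_eq0.
Qed.

Section annuli.
Context (d : measure_display) (R : realType) (X : measurableMetricType d R).
Variables (mu : {measure set X -> \bar R}) (lambda : X -> R -> R).
Hypothesis bX : borel_space X.
Hypothesis ud : upper_doubling mu lambda.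

Lemma dominating_gt0 x r : 0 < r -> 0 < lambda x r.
Proof. by case: ud => + _ _ _ _; exact. Qed.

Lemma dominating_le x r s : 0 < r -> r <= s -> lambda x r <= lambda x s.
Proof. by case: ud => _ + _ _ _; exact. Qed.

Lemma measure_ball_dominated x r : 0 < r -> (mu (ball x r) <= (lambda x r)%:E)%E.
Proof. by case: ud => _ _ _ + _; exact. Qed.

Lemma measure_ball_lty x r : (mu (ball x r) < +oo)%E.
Proof.
have [r0|r0] := ltP 0 r.
  by apply: le_lt_trans (measure_ball_dominated x r0) _; rewrite ltry.
rewrite [X in mu X](_ : _ = set0) ?measure0//; apply/seteqP; split => // y /ballP.
by move=> /lt_le_trans /(_ r0); rewrite ltNge mdist_ge0.
Qed.

Lemma measure_ball_fin x r : mu (ball x r) \is a fin_num.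
Proof. by rewrite ge0_fin_numE// measure_ball_lty. Qed.

Lemma dominating_scale a : 0 < a -> exists2 L, 1 <= L &
  forall x r, 0 < r -> lambda x (a * r) <= L * lambda x r.
Proof.
have [C HC] : exists C : R, forall x r, 0 < r -> lambda x (2 * r) <= C * lambda x r.
  by case: ud.
move=> a0; pose D := Num.max C 1.
have D1 : 1 <= D by rewrite le_max lexx orbT.
have HD n x r : 0 < r -> lambda x (2 ^+ n * r) <= D ^+ n * lambda x r.
  elim: n r => [|n IH] r r0; first by rewrite !expr0 !mul1r.
  rewrite exprSr -mulrA (le_trans (IH _ _))// ?mulr_gt0// exprSr -mulrA ler_wpM2l ?exprn_ge0//
    ?(le_trans ler01)//.
  rewrite (le_trans (HC _ _ r0))// ler_wpM2r ?(ltW (dominating_gt0 _ _))//.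
  by rewrite le_max lexx.
pose n := (Num.truncn a).+1.
exists (D ^+ n); first exact: exprn_ege1.
move=> x r r0; apply: le_trans (HD n _ _ r0).
have an : a <= 2 ^+ n.
  by apply/ltW/(lt_trans (truncnS_gt _)); rewrite -natrX ltr_nat ltn_expl.
by apply: dominating_le; rewrite ?mulr_gt0// ler_pM2r.
Qed.

Lemma doubling_ball (A L : R) (x : X) (rho : R) : 1 <= A -> 1 <= L -> 0 < rho ->
  (forall x r, 0 < r -> lambda x (A * r) <= L * lambda x r) ->
  (exists j, (0 < mu (ball x (A ^+ j * rho)))%E) ->
  exists k, [/\ (1 <= k)%N, (0 < mu (ball x (A ^+ k * rho)))%E,
    (mu (ball x (A ^+ k.+1 * rho)) <= (2 * L)%:E * mu (ball x (A ^+ k * rho)))%E &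
    forall j, (j <= k)%N ->
      (mu (ball x (A ^+ j.+2 * rho)) <= (4 * L ^+ 2 / 2 ^+ (k - j) * lambda x (A ^+ j * rho))%:E)%E].
Proof.
move=> A1 L1 rho0 HL [j0 Hj0].
have A0 : 0 < A by exact: lt_le_trans A1.
pose m j := fine (mu (ball x (A ^+ j * rho))).
have mE j : mu (ball x (A ^+ j * rho)) = (m j)%:E by rewrite fineK// measure_ball_fin.
have r0 j : 0 < A ^+ j * rho by rewrite mulr_gt0// exprn_gt0.
have [k [k1 mk0 mk Hk]] : exists k, [/\ (1 <= k)%N, 0 < m k, m k.+1 <= 2 * L * m k &
    forall j, (j <= k)%N -> m j.+2 <= 4 * L ^+ 2 / 2 ^+ (k - j) * lambda x (A ^+ j * rho)].
  apply: doubling_index => //.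
  - by move=> j; rewrite -lee_fin -mE.
  - by move=> j; rewrite -lee_fin -mE; exact: measure_ball_dominated.
  - move=> j; rewrite -lee_fin -!mE; apply: measure_le; try exact: measurable_mball.
    by apply: le_ball; rewrite ler_pM2r// ler_weXn2l.
  - by move=> j; rewrite exprS -mulrA; exact: HL.
  - by exists j0; rewrite -lte_fin -mE.
by exists k; split => // [||j jk]; rewrite ?mE ?lte_fin// ?lee_fin//; exact: Hk.
Qed.

Definition annulus (x : X) (a b : R) := [set y | a <= mdist x y < b].

Lemma annulusE x a b : annulus x a b = ball x b `\` ball x a.
Proof.
apply/seteqP; split => y; rewrite /annulus /= !ballEmdist /=.
  by move=> /andP[ay yb]; split => //; rewrite ltNge ay.
by move=> [yb /negP]; rewrite -leNgt => ->.
Qed.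

Lemma measurable_annulus x a b : measurable (annulus x a b).
Proof. by rewrite annulusE; apply: measurableD; exact: measurable_mball. Qed.

(** * Kernel-type integrals over concentric annuli *)

Section annulus_integrals.
Variables (A L : R) (x : X) (rho m c : R) (g F : X -> R).
Hypotheses (A1 : 1 < A) (L1 : 1 <= L) (rho0 : 0 < rho) (m0 : 0 <= m) (c0 : 0 <= c).
Hypothesis HL : forall x r, 0 < r -> lambda x (A * r) <= L * lambda x r.
Hypotheses (g0 : forall y, 0 <= g y) (mg : measurable_fun setT g).
Hypothesis (gm : forall s, 0 < s ->
  (\int[mu]_(y in ball x s) (g y)%:E <= m%:E * mu (ball x (A * s)))%E).
Hypotheses (F0 : forall y, 0 <= F y).

Let A0 : 0 < A. Proof. exact: lt_trans A1. Qed.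
Let L0 : 0 <= L. Proof. exact: le_trans L1. Qed.
Let r0 j : 0 < A ^+ j * rho. Proof. by rewrite mulr_gt0// exprn_gt0. Qed.

(** The function g is a density whose means over balls are at most m in the sense of [gm]: either
    |f| with m its maximal function, or the constant 1 with m = 1. The pointwise bound is asked
    almost everywhere because in the second use F is |T b|, and T is known up to null sets. *)
Lemma annulus_step (j : nat) (w M : R) : 0 <= w ->
  measurable_fun (annulus x (A ^+ j * rho) (A ^+ j.+1 * rho)) F ->
  {ae mu, forall y, A ^+ j * rho <= mdist x y < A ^+ j.+1 * rho -> F y <= w * g y} ->
  (mu (ball x (A ^+ j.+2 * rho)) <= M%:E)%E ->
  (\int[mu]_(y in annulus x (A ^+ j * rho) (A ^+ j.+1 * rho)) (F y)%:E <= (w * (m * M))%:E)%E.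
Proof.
move=> w0 mF Fw HM.
have mgE D : measurable_fun D (fun y => (g y)%:E).
  by apply/measurable_EFinP; exact: measurable_funTS.
apply: (@le_trans _ _ (\int[mu]_(y in annulus x (A ^+ j * rho) (A ^+ j.+1 * rho)) (w%:E * (g y)%:E))%E).
  apply: ae_ge0_le_integral => //.
  - exact: measurable_annulus.
  - by move=> y _; rewrite lee_fin.
  - exact/measurable_EFinP.
  - by move=> y _; rewrite -EFinM lee_fin mulr_ge0.
  - apply: emeasurable_funM => //; exact: measurable_cst.
rewrite ge0_integralZl_EFin//; last 2 first.
  exact: measurable_annulus.
  by move=> y _; rewrite lee_fin.
rewrite EFinM lee_wpmul2l ?lee_fin//.
apply: (@le_trans _ _ (\int[mu]_(y in ball x (A ^+ j.+1 * rho)) (g y)%:E)%E).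
  apply: ge0_subset_integral => //.
  - exact: measurable_annulus.
  - exact: measurable_mball.
  - by move=> y _; rewrite lee_fin.
  - by rewrite annulusE; apply: subDsetl.
apply: (le_trans (gm (r0 _))); rewrite EFinM lee_wpmul2l ?lee_fin//.
by apply: le_trans HM; rewrite mulrA -exprS.
Qed.

Lemma annulus_sum (n : nat) (a : nat -> R) :
  measurable_fun (annulus x rho (A ^+ n * rho)) F ->
  (forall j, (j < n)%N -> (\int[mu]_(y in annulus x (A ^+ j * rho) (A ^+ j.+1 * rho)) (F y)%:E <=
    (a j)%:E)%E) ->
  (\int[mu]_(y in annulus x rho (A ^+ n * rho)) (F y)%:E <= (\sum_(j < n) a j)%:E)%E.
Proof.
elim: n => [|n IH] mF Ha.
  rewrite big_ord0 expr0 mul1r [X in integral _ X _](_ : _ = set0) ?integral_set0//.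
  by apply/seteqP; split => // y /andP[h1 /lt_le_trans /(_ h1)]; rewrite ltxx.
have lA : A ^+ n * rho <= A ^+ n.+1 * rho by rewrite ler_pM2r// ler_eXn2l.
have rA : rho <= A ^+ n * rho by rewrite ler_peMl// ?(ltW rho0)// exprn_ege1// ltW.
have dU : annulus x rho (A ^+ n.+1 * rho) =
    annulus x rho (A ^+ n * rho) `|` annulus x (A ^+ n * rho) (A ^+ n.+1 * rho).
  apply/seteqP; split => y; rewrite /annulus/=.
    by move=> /andP[h1 h2]; have [h3|h3] := ltP (mdist x y) (A ^+ n * rho); [left; rewrite h1|right].
  move=> [/andP[h1 h2]|/andP[h1 h2]]; first by rewrite h1 (lt_le_trans h2).
  by rewrite h2 (le_trans rA).
rewrite dU in mF *.
rewrite ge0_integral_setU//; last 5 first.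
  exact: measurable_annulus.
  exact: measurable_annulus.
  exact/measurable_EFinP.
  by move=> y _; rewrite lee_fin.
  apply/disj_setPS => y [/= /andP[_ h1] /andP[h2 _]].
  by move: (lt_le_trans h1 h2); rewrite ltxx.
rewrite big_ord_recr /= EFinD; apply: leeD; last exact: Ha.
apply: IH => [|j jn]; last by apply: Ha; exact: ltnW.
by apply: measurable_funS mF; [apply: measurableU; exact: measurable_annulus|exact: subsetUl].
Qed.

(** On annulus j the weight is at most c / lambda at scale j, and the mass is at most 4 L^2 /
    2^(k-j) times the same lambda, which cancels. Summing 2^-(k-j) over j <= k gives the remaining
    factor 2. *)
Lemma near_annulus_integral (k : nat) :
  (forall j, (j <= k)%N ->
      (mu (ball x (A ^+ j.+2 * rho)) <= (4 * L ^+ 2 / 2 ^+ (k - j) * lambda x (A ^+ j * rho))%:E)%E) ->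
  measurable_fun (annulus x rho (A ^+ k.+1 * rho)) F ->
  {ae mu, forall y, rho <= mdist x y < A ^+ k.+1 * rho -> F y <= c / lambda x (mdist x y) * g y} ->
  (\int[mu]_(y in annulus x rho (A ^+ k.+1 * rho)) (F y)%:E <= (8 * L ^+ 2 * c * m)%:E)%E.
Proof.
move=> Hk mF Fc.
have rA j : rho <= A ^+ j * rho by rewrite ler_peMl// ?(ltW rho0)// exprn_ege1// ltW.
have S2 n : \sum_(j < n) (2 ^+ (n - j))^-1 <= 1 :> R.
  elim: n => [|n IH]; first by rewrite big_ord0.
  rewrite big_ord_recr /= subSnn expr1.
  have -> : \sum_(i < n) (2 ^+ (n.+1 - i))^-1 = 2^-1 * \sum_(i < n) (2 ^+ (n - i))^-1 :> R.
    rewrite mulr_sumr; apply: eq_bigr => i _.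
    by rewrite subSn ?exprS ?invfM// ltnW.
  by rewrite -lerBrDr (_ : 1 - 2^-1 = 2^-1 * 1 :> R); [rewrite ler_pM2l//|field].
apply: le_trans (annulus_sum (a := fun j => 4 * L ^+ 2 * c * m / 2 ^+ (k - j)) mF _) _.
  move=> j jk.
  have l0 : 0 < lambda x (A ^+ j * rho) by exact: dominating_gt0.
  have -> : 4 * L ^+ 2 * c * m / 2 ^+ (k - j) = c / lambda x (A ^+ j * rho) * (m * (4 * L ^+ 2 / 2
    ^+ (k - j) * lambda x (A ^+ j * rho))).
    by field; rewrite ?gt_eqF// ?exprn_gt0.
  have sub : annulus x (A ^+ j * rho) (A ^+ j.+1 * rho) `<=` annulus x rho (A ^+ k.+1 * rho).
    move=> y /andP[h1 h2]; apply/andP; split; first exact: le_trans h1.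
    by apply: (lt_le_trans h2); rewrite ler_pM2r// ler_eXn2l.
  apply: annulus_step.
  - by rewrite divr_ge0// ltW.
  - by apply: measurable_funS sub mF; exact: measurable_annulus.
  - apply: filterS Fc => y h hy; apply: le_trans (h _) _; first exact: sub.
    rewrite ler_wpM2r// ler_wpM2l// lef_pV2 ?posrE//; last first.
      by apply: dominating_gt0; case/andP: hy => [hy _]; exact: lt_le_trans hy.
    by apply: dominating_le => //; case/andP: hy.
  - exact: Hk.
rewrite lee_fin.
have -> : \sum_(j < k.+1) 4 * L ^+ 2 * c * m / 2 ^+ (k - j) = 8 * L ^+ 2 * c * m * \sum_(j < k.+1)
  (2 ^+ (k.+1 - j))^-1.
  rewrite mulr_sumr; apply: eq_bigr => j _; rewrite subSn -1?ltnS// (exprS 2).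
  by field; rewrite ?gt_eqF// ?exprn_gt0.
by rewrite ler_piMr// !mulr_ge0.
Qed.

(** Here the mass is simply dominated by lambda, two scales up at the price L^2. Convergence comes
    from smoothness instead: the factor (rho / d)^delta is at most A^(-j delta) on annulus j, and
    the geometric series is bounded by 1 / (1 - A^(-delta)). *)
Lemma far_annulus_integral (delta : R) : 0 < delta ->
  measurable_fun [set y | rho <= mdist x y] F ->
  {ae mu, forall y, rho <= mdist x y ->
     F y <= c * (rho `^ delta / (mdist x y `^ delta * lambda x (mdist x y))) * g y} ->
  (\int[mu]_(y in [set y | (rho <= mdist x y)%R]) (F y)%:E <= (L ^+ 2 / (1 - (A `^ delta)^-1) * c * m)%:E)%E.
Proof.
move=> delta0 mF Fc.
pose q := (A `^ delta)^-1.
have Ad : 1 < A `^ delta by have := @gt0_ltr_powR R delta delta0 1 A; rewrite powR1; apply;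
  rewrite ?nnegrE// ltW.
have q0 : 0 < q by rewrite invr_gt0 (lt_trans ltr01).
have q1 : q < 1 by rewrite invf_lt1// (lt_trans ltr01).
have rA j : rho <= A ^+ j * rho by rewrite ler_peMl// ?(ltW rho0)// exprn_ege1// ltW.
pose E n := annulus x rho (A ^+ n * rho).
have sE n : E n `<=` [set y | rho <= mdist x y] by move=> y /andP[].
have mE n : measurable_fun (E n) F.
  by apply: measurable_funS (sE n) mF; exact: measurable_mdist_ge.
have -> : [set y | rho <= mdist x y] = \bigcup_n E n.
  apply/seteqP; split => [y /= ry|y [n _ /sE//]].
  have [n hn] : exists n, mdist x y < A ^+ n * rho.
    have [n hn] := exprn_unbounded (mdist x y / rho) A1.
    by exists n; rewrite -ltr_pdivrMr.
  by exists n => //; apply/andP.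
have cv := @ge0_nondecreasing_set_cvg_integral _ X R E (fun y => (F y)%:E) mu.
apply: (cvge_le _ (cv _ _ _ _)).
- apply: nearW => n.
  apply: le_trans (annulus_sum (a := fun j => L ^+ 2 * c * m * q ^+ j) (mE n) _) _.
    move=> j jn.
    have l0 : 0 < lambda x (A ^+ j * rho) by exact: dominating_gt0.
    have -> : L ^+ 2 * c * m * q ^+ j = c * q ^+ j / lambda x (A ^+ j * rho) * (m * (L ^+ 2 *
      lambda x (A ^+ j * rho))).
      by field; rewrite gt_eqF.
    have sub : annulus x (A ^+ j * rho) (A ^+ j.+1 * rho) `<=` [set y | rho <= mdist x y].
      by move=> y /andP[h1 h2]; exact: le_trans h1.
    apply: annulus_step.
    + by rewrite divr_ge0 ?(ltW l0)// mulr_ge0// exprn_ge0// ltW.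
    + by apply: measurable_funS sub mF; exact: measurable_mdist_ge.
    + apply: filterS Fc => y h hy; apply: le_trans (h _) _; first exact: sub.
      rewrite ler_wpM2r// -mulrA ler_wpM2l//.
      case/andP: hy => h1 h2.
      have d0 : 0 < mdist x y by exact: lt_le_trans h1.
      rewrite invfM mulrA ler_pM//.
      * by rewrite divr_ge0// powR_ge0.
      * by rewrite invr_ge0 ltW// dominating_gt0.
      * have -> : q ^+ j = rho `^ delta / (A ^+ j * rho) `^ delta.
          have -> : (A ^+ j * rho) `^ delta = (A `^ delta) ^+ j * rho `^ delta.
            rewrite powRM ?exprn_ge0 ?ltW//; congr (_ * _).
            by rewrite -(powR_mulrn j (ltW A0)) -powRrM mulrC powRrM powR_mulrn ?powR_ge0.
          by rewrite /q exprVn; field; rewrite !gt_eqF// ?exprn_gt0// powR_gt0.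
        rewrite ler_wpM2l ?powR_ge0// lef_pV2 ?posrE ?powR_gt0//.
        by rewrite ge0_ler_powR ?nnegrE// ltW.
      * by rewrite lef_pV2 ?posrE ?dominating_gt0//; exact: dominating_le.
    + apply: (le_trans (measure_ball_dominated _ (r0 _))); rewrite lee_fin.
      rewrite exprS -mulrA (le_trans (HL _ (r0 _)))// expr2 -mulrA ler_wpM2l ?(le_trans ler01)//.
      by rewrite exprS -mulrA; exact: HL.
  rewrite lee_fin -mulr_sumr.
  have -> : L ^+ 2 / (1 - q) * c * m = L ^+ 2 * c * m * (1 - q)^-1.
    by field; rewrite subr_eq0 gt_eqF.
  rewrite ler_wpM2l ?mulr_ge0 ?sqr_ge0//.
  rewrite -[leRHS]mul1r ler_pdivlMr ?subr_gt0// [leLHS]mulrC.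
  have -> : (1 - q) * \sum_(j < n) q ^+ j = 1 - q ^+ n.
    by rewrite -[RHS]opprB subrX1 -mulNr opprB.
  by rewrite lerBlDr lerDl exprn_ge0// ltW.
- move=> n k nk; apply/subsetPset => y /andP[h1 h2]; apply/andP; split => //.
  by apply: (lt_le_trans h2); rewrite ler_pM2r// ler_eXn2l.
- by move=> n; exact: measurable_annulus.
- by move=> n; exact/measurable_EFinP.
- by move=> n y _; rewrite lee_fin.
Qed.

End annulus_integrals.

End annuli.

(** * Bounded functions with bounded support *)

Section bounded_functions.
Context (d : measure_display) (R : realType) (X : measurableMetricType d R).
Variables (mu : {measure set X -> \bar R}).
Hypothesis bX : borel_space X.
Hypothesis mu_lty : forall (x : X) r, (mu (ball x r) < +oo)%E.

(** The class of all functions to which T is applied below. It is contained in L^2 and in the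
    bounded functions with bounded support, so every assumption on T applies, and it is stable under
    sums and cutoffs. The last condition bears on the set where f is nonzero and not on its closure,
    which makes this stability immediate. *)
Definition bounded_bsupp (f : X -> R[i]) : Prop :=
  [/\ cmeasurable setT f, exists M, forall y, normc (f y) <= M &
      exists x r, forall y, f y <> 0 -> ball x r y].

Lemma bounded_bsuppD f g : bounded_bsupp f -> bounded_bsupp g ->
  bounded_bsupp (fun y => f y + g y).
Proof.
move=> [mf [M fM] [x [r fr]]] [mg [N gN] [z [s gs]]]; split.
- exact: cmeasurableD.
- by exists (M + N) => y; rewrite (le_trans (le_normcD _ _))// lerD.
exists x, (Num.max r (mdist x z + s)) => y fgy; apply/ballP; rewrite lt_max.
have [fy|/fr /ballP ->//] := pselect (f y = 0).
have /gs/ballP zy : g y <> 0 by move=> gy; apply: fgy; rewrite fy gy addr0.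
by apply/orP; right; apply: le_lt_trans (metric_triangle x z y) _; rewrite ltrD2l.
Qed.

Lemma bounded_bsuppZ (a : R[i]) f : bounded_bsupp f -> bounded_bsupp (fun y => a * f y).
Proof.
move=> [mf [M fM] [x [r fr]]]; split.
- by apply: cmeasurableM => //; exact: cmeasurable_cst.
- by exists (normc a * M) => y; rewrite normcM ler_wpM2l// normc_ge0.
by exists x, r => y afy; apply: fr => fy; apply: afy; rewrite fy mulr0.
Qed.

Lemma bounded_bsupp_indic (A : set X) f : measurable A -> bounded_bsupp f ->
  bounded_bsupp (fun y => ((\1_A y)%:C)%C * f y).
Proof.
move=> mA [mf [M fM] [x [r fr]]]; split.
- by apply: cmeasurableM => //; exact: cmeasurable_indic.
- exists M => y; rewrite normcM normc_real indicE ger0_norm// (le_trans _ (fM y))//.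
  by rewrite ler_piMl ?normc_ge0//; case: (_ \in _).
by exists x, r => y afy; apply: fr => fy; apply: afy; rewrite fy mulr0.
Qed.

Lemma bounded_bsupp_ball (a : R[i]) x r : bounded_bsupp (fun y => a * ((\1_(ball x r) y)%:C)%C).
Proof.
apply: bounded_bsuppZ; split.
- by apply: cmeasurable_indic; exact: measurable_mball.
- by exists 1 => y; rewrite normc_real indicE ger0_norm//; case: (_ \in _).
by exists x, r => y; rewrite indicE; have [/set_mem//|] := boolP (y \in (ball x r : set X)).
Qed.

Lemma bounded_bsupp_sum (I : Type) (s : seq I) (F : I -> X -> R[i]) :
  (forall i, bounded_bsupp (F i)) -> bounded_bsupp (fun x => \sum_(i <- s) F i x).
Proof.
move=> mF; elim: s => [|i s IH].
  under eq_fun do rewrite big_nil; split; [exact: cmeasurable_cst|exists 0|by exists point, 0] => y.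
  by rewrite normc0.
by under eq_fun do rewrite big_cons; exact: bounded_bsuppD.
Qed.

Lemma bounded_integral_lty (D : set X) (h : X -> R) M x r : measurable D ->
  measurable_fun D h -> (forall y, 0 <= h y <= M) -> (forall y, h y <> 0 -> ball x r y) ->
  (\int[mu]_(y in D) (h y)%:E < +oo)%E.
Proof.
move=> mD mh hM hr.
have M0 : 0 <= M by have /andP[h1 h2] := hM x; exact: le_trans h2.
have mB := @measurable_mball _ _ _ bX x r.
apply: (@le_lt_trans _ _ (\int[mu]_(y in D) (M%:E * (\1_(ball x r) y)%:E))%E).
  apply: ge0_le_integral => //.
  - by move=> y _; rewrite lee_fin; case/andP: (hM y).
  - exact/measurable_EFinP.
  - apply: emeasurable_funM; first exact: measurable_cst.
    by apply/measurable_EFinP; exact: measurable_indic.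
  move=> y _; rewrite -EFinM lee_fin indicE.
  have [->|/hr hy] := pselect (h y = 0); first by rewrite mulr_ge0.
  by rewrite mem_set// mulr1; case/andP: (hM y).
rewrite ge0_integralZl_EFin//; last by apply/measurable_EFinP; exact: measurable_indic.
rewrite integral_indic//; apply: lte_mul_pinfty => //.
by apply: le_lt_trans (mu_lty x r); apply: measure_le => //; exact: measurableI.
Qed.

Lemma bounded_bsupp_int_lty D f (n : nat) : measurable D -> bounded_bsupp f ->
  (\int[mu]_(y in D) (normc (f y) ^+ n.+1)%:E < +oo)%E.
Proof.
move=> mD [mf [M fM] [x [r fr]]].
apply: (@bounded_integral_lty _ _ (M ^+ n.+1) x r) => //.
- by apply: measurable_funX; apply: measurable_normc; exact: cmeasurableS mf.
- by move=> y; rewrite exprn_ge0 ?normc_ge0//= lerXn2r// ?nnegrE ?(le_trans _ (fM y)) ?normc_ge0.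
- by move=> y hy; apply: fr => fy; apply: hy; rewrite fy normc0 expr0n.
Qed.

Lemma bounded_bsupp_cintegrable D f : measurable D -> bounded_bsupp f ->
  cintegrable mu D f.
Proof.
move=> mD bf; apply: cintegrableP => //.
  by case: bf => mf _ _; exact: cmeasurableS mf.
by have := bounded_bsupp_int_lty 0 mD bf.
Qed.

Lemma bounded_bsupp_L2 f : bounded_bsupp f -> cLfun mu 2%:E f.
Proof.
move=> bf; split; first by case: bf.
by apply: cLnorm2_lty; exact: bounded_bsupp_int_lty.
Qed.

Lemma bounded_bsupp_Loo f : bounded_bsupp f -> cLfun mu +oo%E f.
Proof. by move=> [mf [M fM] _]; split => //; exact: cLnormy_lty fM. Qed.

Lemma supp_le x r (f : X -> R[i]) : (forall y, f y <> 0 -> mdist x y <= r) ->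
  supp f `<=` [set y | mdist x y <= r].
Proof.
move=> fr y fy /=; rewrite leNgt; apply/negP => ry.
have e0 : 0 < mdist x y - r by rewrite subr_gt0.
have [z /= [fz /ballP yz]] := fy _ (nbhsx_ballx y _ e0).
have := fr z (elimN eqP fz); apply/negP; rewrite -ltNge.
rewrite metric_sym in yz; have := metric_triangle x z y; lra.
Qed.

Lemma bounded_bsupp_supp f : bounded_bsupp f -> bounded_supp f.
Proof.
(* The closure of the set where f is nonzero is only confined to the closed ball of radius r, hence
   the larger radius. *)
move=> [_ _ [x [r fr]]]; exists x, (r + 1).
apply: subset_trans (@supp_le x r f _) _; first by move=> y /fr /ballP /ltW.
by move=> y /= xy; apply/ballP; apply: (le_lt_trans xy); rewrite ltrDl.
Qed.

(** * The operator on bounded functions with bounded support *)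

Section operator.
Variables (lambda : X -> R -> R) (K : X -> X -> R[i]) (T : (X -> R[i]) -> X -> R[i]).
Hypothesis cz : cz_operator mu lambda K T.
Hypothesis T2 : L2_bounded mu T.

Lemma operator_measurable f : bounded_bsupp f -> cmeasurable setT (T f).
Proof. by case: T2 => B B0 HB /bounded_bsupp_L2 /HB [[]]. Qed.

Lemma operator_L2 : exists2 B : R, 0 <= B & forall f, bounded_bsupp f ->
  (\int[mu]_x (normc (T f x) ^+ 2)%:E <= B%:E * \int[mu]_x (normc (f x) ^+ 2)%:E)%E.
Proof.
case: T2 => B B0 HB; exists (B ^+ 2); first exact: sqr_ge0.
by move=> f /bounded_bsupp_L2 /HB [_]; exact: cLnorm2_le.
Qed.

Lemma operatorD f g : bounded_bsupp f -> bounded_bsupp g ->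
  {ae mu, forall x, T (fun y => f y + g y) x = T f x + T g x}.
Proof.
move=> /bounded_bsupp_L2 bf /bounded_bsupp_L2 bg.
case: cz => _ lin _; have := lin 1 f g bf bg.
apply: filterS => x; rewrite mul1r => <-; congr T.
by apply/funext => y; rewrite mul1r.
Qed.

(** Each addition holds off a null set, and finitely many null sets are collected; a finite
    decomposition avoids any limit under T. *)
Lemma operator_sum (I : Type) (s : seq I) f (b : I -> X -> R[i]) :
  bounded_bsupp f -> (forall i, bounded_bsupp (b i)) ->
  {ae mu, forall x, T (fun y => f y + \sum_(i <- s) b i y) x = T f x + \sum_(i <- s) T (b i) x}.
Proof.
move=> bf bb; elim: s => [|i s IH].
  apply: aeW => x; rewrite big_nil addr0; congr T.
  by apply/funext => y; rewrite big_nil addr0.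
have bs : bounded_bsupp (fun y => f y + \sum_(i <- s) b i y).
  by apply: bounded_bsuppD => //; exact: bounded_bsupp_sum.
have := operatorD bs (bb i).
apply: filterS2 IH => x; rewrite big_cons => IH.
have -> : (fun y => f y + \sum_(i <- s) b i y + b i y) = (fun y => f y + \sum_(i <- i :: s) b i y).
  by apply/funext => y; rewrite big_cons -addrA [in LHS](addrC (\sum_(i <- s) _)).
by move=> ->; rewrite IH -addrA [in LHS](addrC (\sum_(i <- s) _)).
Qed.

Lemma operator_kernel f : bounded_bsupp f ->
  {ae mu, forall x, ~ supp f x -> T f x = cintegral mu setT (fun y => K x y * f y)}.
Proof.
by move=> bf; case: cz => _ _; apply; [exact: bounded_bsupp_Loo|exact: bounded_bsupp_supp].
Qed.

Hypothesis gd : geometrically_doubling X.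

(** Measurability of K is joint and off the diagonal; the map sending y to (x, y) takes D there
    because x is not in D. *)
Lemma kernel_measurable x D : measurable D -> ~ D x -> cmeasurable D (K x).
Proof.
move=> mD Dx; case: cz => -[[[m1 m2] _] _] _ _.
have mO := measurable_off_diagonal bX gd.
have sD : [set (x, y) | y in D] `<=` @off_diagonal d R X.
  by move=> _ [y Dy <-] /= xy; apply: Dx; move: xy => /= ->.
have mp : measurable_fun D (pair x) by apply: measurable_funTS; exact: pair1_measurable.
split.
  exact: (measurable_comp mO sD m1 mp).
exact: (measurable_comp mO sD m2 mp).
Qed.

End operator.

Lemma cintegral_bounded_mul (D : set X) (k b : X -> R[i]) (M : R) : measurable D ->
  cmeasurable D k -> bounded_bsupp b -> (forall y, D y -> normc (k y) <= M) -> 0 <= M ->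
  cintegrable mu D (fun y => k y * b y) /\
  ((normc (cintegral mu D (fun y => k y * b y)))%:E <=
    2%:E * (M%:E * \int[mu]_(y in D) (normc (b y))%:E))%E.
Proof.
move=> mD mk bb kM M0; case: (bb) => mb _ _.
have mbD : cmeasurable D b by exact: cmeasurableS mb.
have mkb : cmeasurable D (fun y => k y * b y) by exact: cmeasurableM.
have le : (\int[mu]_(y in D) (normc (k y * b y))%:E <= M%:E * \int[mu]_(y in D) (normc (b y))%:E)%E.
  rewrite -ge0_integralZl_EFin//; last 2 first.
    by move=> y _; rewrite lee_fin normc_ge0.
    by apply/measurable_EFinP; exact: measurable_normc.
  apply: ge0_le_integral => //.
  - by move=> y _; rewrite lee_fin normc_ge0.
  - by apply/measurable_EFinP; exact: measurable_normc.
  - apply: emeasurable_funM; first exact: measurable_cst.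
    by apply/measurable_EFinP; exact: measurable_normc.
  - by move=> y Dy; rewrite -EFinM lee_fin normcM ler_wpM2r ?normc_ge0// kM.
split.
  apply: cintegrableP => //; apply: (le_lt_trans le).
  by apply: lte_mul_pinfty => //; exact: (bounded_bsupp_int_lty 0 mD bb).
by apply: (le_trans (normc_cintegral_le mu mD mkb)); rewrite lee_wpmul2l.
Qed.

End bounded_functions.

(** * Covering and overlap estimates *)

Section measure_tools.
Context (d : measure_display) (T : measurableType d) (R : realType).
Variable mu : {measure set T -> \bar R}.

Lemma measure_le_ae (A B : set T) : measurable A -> measurable B ->
  {ae mu, forall x, A x -> B x} -> (mu A <= mu B)%E.
Proof.
move=> mA mB [N [mN N0 NAB]].
rewrite -[leRHS]adde0 -N0; apply: (le_trans _ (measureU2 _ _ _)) => //.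
apply: measure_le => //; first exact: measurableU.
move=> x Ax; have [Bx|Bx] := pselect (B x); first by left.
by right; apply: NAB => /= /(_ Ax).
Qed.

Lemma chebyshev_gt (D : set T) (g : T -> R) (t : R) : measurable D -> measurable_fun D g ->
  (forall x, 0 <= g x) -> 0 <= t ->
  (t%:E * mu (D `&` [set x | (t < g x)%R]) <= \int[mu]_(x in D) (g x)%:E)%E.
Proof.
move=> mD mg g0 t0.
have mE : measurable (D `&` [set x | t < g x]).
  have := mg mD _ (measurable_itv `]t, +oo[); congr measurable; congr (_ `&` _).
  by apply/seteqP; split => x; rewrite /= in_itv/= andbT.
rewrite -integral_cst//.
apply: (@le_trans _ _ (\int[mu]_(x in D `&` [set x | (t < g x)%R]) (g x)%:E)%E).
  apply: ge0_le_integral => //; first by apply/measurable_EFinP; apply: measurable_funS mg.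
  by move=> x [_ /ltW].
apply: ge0_subset_integral => //; first exact/measurable_EFinP.
by move=> x _; rewrite lee_fin.
Qed.

Lemma gt_measurable (g : T -> R) (t : R) : measurable_fun setT g -> measurable [set x | t < g x].
Proof.
move=> mg; have := mg measurableT _ (measurable_itv `]t, +oo[); rewrite setTI; congr measurable.
by apply/seteqP; split => x; rewrite /= in_itv/= andbT.
Qed.

End measure_tools.

(** Selects the last stopping scale; the alternative [k0 = 0] covers the case in which no scale
    stops. *)
Lemma last_index (p : nat -> bool) : (exists N, forall k, (N <= k)%N -> ~~ p k) ->
  exists k0, (k0 = 0%N \/ p k0) /\ forall k, (k0 < k)%N -> ~~ p k.
Proof.
move=> [N]; elim: N => [|N IH] HN; first by exists 0%N; split; [left|move=> k _; exact: HN].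
have [pN|pN] := boolP (p N); first by exists N; split; [right|].
by apply: IH => k; rewrite leq_eqVlt => /predU1P[<-//|]; exact: HN.
Qed.

Lemma exists_max_seq (R : realDomainType) (I : eqType) (s : seq I) (r : I -> R) : s != [::] ->
  exists2 j, j \in s & forall i, i \in s -> r i <= r j.
Proof.
elim: s => // i s IH _; have [->|s0] := eqVneq s [::].
  by exists i; rewrite ?mem_head// => j; rewrite inE => /eqP ->.
have [j js jmax] := IH s0; have [ij|ji] := leP (r i) (r j).
  by exists j; rewrite ?inE ?js ?orbT// => k; rewrite inE => /predU1P[->//|/jmax].
exists i; rewrite ?mem_head// => k; rewrite inE => /predU1P[->//|/jmax] h.
by apply: (le_trans h); exact: ltW.
Qed.

Section coverings.
Context (d : measure_display) (R : realType) (X : measurableMetricType d R).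
Variables (mu : {measure set X -> \bar R}).
Hypothesis bX : borel_space X.
Variable (g : X -> R).
Hypotheses (g0 : forall y, 0 <= g y) (mg : measurable_fun setT g).
Local Notation nu D := (\int[mu]_(y in D) (g y)%:E)%E.

Let mgE D : measurable_fun D (fun y => (g y)%:E).
Proof. by apply/measurable_EFinP; exact: measurable_funTS. Qed.

Lemma weighted_mono D D' : measurable D -> measurable D' -> D `<=` D' -> (nu D <= nu D')%E.
Proof.
by move=> mD mD' DD'; apply: ge0_subset_integral => // y _; rewrite lee_fin.
Qed.

(** Greedy selection: take the largest ball and discard every ball whose triple meets its triple. A
    discarded ball lies within 3 r_j + 3 r_i + r_i <= 7 r_j of x_j, which is the origin of 7 <= A.
    The triples of the selected balls are disjoint, so their integrals of g add up. Since the
    hypothesis compares [mu] on the large ball directly with the integral on the triple, no doubling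
    of [mu] enters. *)
Lemma finite_vitali (I : eqType) (s : seq I) (x : I -> X) (r : I -> R) (t A : R) :
  0 < t -> 7 <= A -> (forall i, 0 < r i) ->
  (forall i, i \in s -> (t%:E * mu (ball (x i) (A * r i)) <= nu (ball (x i) (3 * r i)))%E) ->
  (t%:E * mu (\bigcup_(i in [set` s]) ball (x i) (r i)) <=
   nu (\bigcup_(i in [set` s]) ball (x i) (3 * r i)))%E.
Proof.
move=> t0 A7 r0; have [n] := ubnP (size s); elim: n s => // n IH s sn Hs.
have mU (s' : seq I) (a : R) : measurable (\bigcup_(i in [set` s']) ball (x i) (a * r i)).
  by apply: fin_bigcup_measurable => // i _; exact: measurable_mball.
have mU1 (s' : seq I) : measurable (\bigcup_(i in [set` s']) ball (x i) (r i)).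
  by apply: fin_bigcup_measurable => // i _; exact: measurable_mball.
have [s0|s0] := eqVneq s [::].
  rewrite s0 [X in mu X](_ : _ = set0) ?measure0 ?mule0; last by apply/seteqP; split => // y [].
  by apply: integral_ge0 => y _; rewrite lee_fin.
have [j js jmax] := exists_max_seq r s0.
pose meets i := `[< ball (x i) (3 * r i) `&` ball (x j) (3 * r j) !=set0 >].
pose s' := [seq i <- s | ~~ meets i].
have ss' : {subset s' <= s} by move=> i; rewrite mem_filter => /andP[].
have jj : meets j.
  by apply/asboolP; exists (x j); split; apply: ballxx; rewrite mulr_gt0.
have s's : (size s' < size s)%N.
  rewrite size_filter -(count_predC meets s) -[ltnLHS]add0n ltn_add2r -has_count.
  by apply/hasP; exists j.
have {}IH := IH s' (leq_trans s's sn) (fun i h => Hs i (ss' i h)).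
have cover : \bigcup_(i in [set` s]) ball (x i) (r i) `<=`
    ball (x j) (A * r j) `|` \bigcup_(i in [set` s']) ball (x i) (r i).
  move=> y [i /= si iy]; have [mi|mi] := boolP (meets i); last first.
    by right; exists i => //=; rewrite mem_filter mi.
  left; move/asboolP : mi => [z [/ballP iz /ballP jz]]; apply/ballP.
  move/ballP in iy; rewrite metric_sym in iz.
  have := mdist_lt_trans (mdist_lt_trans jz iz) iy.
  by move=> h; apply: (lt_le_trans h); have := jmax _ si; have := r0 j; nra.
have mj a := measurable_mball bX (x j) a.
apply: (@le_trans _ _ (t%:E * (mu (ball (x j) (A * r j)) + mu (\bigcup_(i in [set` s']) ball (x i)
  (r i))))%E).
  rewrite lee_wpmul2l ?lee_fin ?(ltW t0)//.
  apply: (le_trans _ (measureU2 _ _ _)) => //.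
  by apply: measure_le => //; exact: measurableU.
rewrite ge0_muleDr//.
apply: (@le_trans _ _ (nu (ball (x j) (3 * r j)) + nu (\bigcup_(i in [set` s']) ball (x i) (3 * r i)))%E).
  by apply: leeD => //; exact: Hs.
rewrite -ge0_integral_setU//; last 2 first.
  by move=> y _; rewrite lee_fin.
  apply/disj_setPS => y [/= yj [i /=]]; rewrite mem_filter => /andP[/asboolP mi _] yi.
  by apply: mi; exists y.
apply: weighted_mono => //; first exact: measurableU.
move=> y [yj|[i /= /ss' si yi]]; [by exists j|by exists i].
Qed.

(** The balls may overlap heavily, but the pieces are disjoint. For fixed i, the balls B_j that meet
    B_i and are not larger lie in B(x_i, 3 rho_i), hence so do their pieces, whose masses al_j add
    up to at most t m_i. With a_i = al_i / m_i, each a_j mu(B_i & B_j) is at most al_j, so row i of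
    the ordered double sum is at most a_i t m_i = t al_i. *)
Lemma overlap_square (n : nat) (x : 'I_n -> X) (rho al m : 'I_n -> R) (P : 'I_n -> set X) (t : R) :
  (forall i, measurable (P i)) -> (forall i, P i `<=` ball (x i) (rho i)) ->
  (forall i j, i != j -> P i `&` P j = set0) ->
  (forall i, nu (P i) = (al i)%:E) -> (forall i, 0 <= al i) ->
  (forall i, mu (ball (x i) (rho i)) = (m i)%:E) -> (forall i, 0 < m i) ->
  (forall i, (nu (ball (x i) (3 * rho i)) <= (t * m i)%:E)%E) ->
  (\int[mu]_y ((\sum_i al i / m i * \1_(ball (x i) (rho i)) y) ^+ 2)%:E <=
   (2 * t * \sum_i al i)%:E)%E.
Proof.
move=> mP PB Pd nuP al0 muB m0 H3.
pose a i := al i / m i.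
have a0 i : 0 <= a i by rewrite divr_ge0// ltW.
pose Bi i := ball (x i) (rho i) : set X.
have mB i : measurable (Bi i) by exact: measurable_mball.
have fin i j : mu (Bi i `&` Bi j) \is a fin_num.
  rewrite ge0_fin_numE//; apply: (@le_lt_trans _ _ (mu (Bi i))).
    by apply: measure_le => //; exact: measurableI.
  by rewrite muB ltry.
pose q i j := fine (mu (Bi i `&` Bi j)).
have q0 i j : 0 <= q i j by rewrite fine_ge0.
have qC i j : q i j = q j i by rewrite /q setIC.
have qm i j : q i j <= m j.
  rewrite -lee_fin /q fineK// -muB; apply: measure_le; [exact: measurableI|exact: mB|by move=> z []].
pose w i j := a i * a j * q i j.
have aa0 i j : 0 <= a i * a j by exact: mulr_ge0.
have w0 i j : 0 <= w i j by exact: mulr_ge0.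
have E1 : (\int[mu]_y ((\sum_i a i * \1_(Bi i) y) ^+ 2)%:E = (\sum_i \sum_j w i j)%:E)%E.
  transitivity (\int[mu]_y (\sum_i \sum_j (a i * a j)%:E * (\1_(Bi i `&` Bi j) y)%:E)%E)%E.
    apply: eq_integral => y _; rewrite expr2 mulr_suml -sumEFin; apply: eq_bigr => i _.
    rewrite mulr_sumr -sumEFin; apply: eq_bigr => j _; rewrite -EFinM; congr EFin.
    by rewrite indicI /=; ring.
  have mi i j : measurable_fun setT (fun y => (a i * a j)%:E * (\1_(Bi i `&` Bi j) y)%:E)%E.
    apply: emeasurable_funM; first exact: measurable_cst.
    by apply/measurable_EFinP; apply: measurable_indic; exact: measurableI.
  have p0 i j y : (0 <= (a i * a j)%:E * (\1_(Bi i `&` Bi j) y)%:E)%E.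
    by rewrite -EFinM lee_fin; exact: mulr_ge0.
  rewrite ge0_integral_sum//; last 2 first.
    by move=> i; apply: emeasurable_sum.
    by move=> i y _; apply: sume_ge0.
  rewrite -sumEFin; apply: eq_bigr => i _.
  rewrite ge0_integral_sum// -sumEFin; apply: eq_bigr => j _.
  rewrite ge0_integralZl_EFin//; last first.
    by apply/measurable_EFinP; apply: measurable_indic; exact: measurableI.
  rewrite integral_indic//; last exact: measurableI.
  by rewrite setIT /w (EFinM _ (q i j)) /q fineK.
rewrite E1 lee_fin.
(* By symmetry of w; pairs of equal radii are counted twice on the right, whence an inequality. *)
have half : \sum_i \sum_j w i j <= 2 * \sum_i \sum_(j | rho j <= rho i) w i j.
  have -> : 2 * \sum_i \sum_(j | rho j <= rho i) w i j =
      \sum_i \sum_(j | rho j <= rho i) w i j + \sum_j \sum_(i | rho j <= rho i) w i j.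
    rewrite mulr2n mulrDl mul1r; congr (_ + _); rewrite [RHS](exchange_big_dep predT)//=.
  have -> : \sum_j \sum_(i | rho j <= rho i) w i j = \sum_i \sum_(j | rho i <= rho j) w i j.
    by apply: eq_bigr => i _; apply: eq_bigr => j _; rewrite /w qC [a j * _]mulrC.
  rewrite -big_split /=; apply: ler_sum => i _.
  rewrite [\sum_(j | rho j <= rho i) _]big_mkcond [\sum_(j | rho i <= rho j) _]big_mkcond.
  rewrite -big_split /=; apply: ler_sum => j _.
  by case: (leP (rho j) (rho i)) => h; [rewrite lerDl; case: ifP|rewrite (ltW h) add0r].
apply: (le_trans half); rewrite -mulrA ler_pM2l// mulr_sumr; apply: ler_sum => i _.
pose good j := (rho j <= rho i) && `[< (Bi i `&` Bi j) !=set0 >].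
have sumgood : \sum_(j | good j) al j <= t * m i.
  rewrite -lee_fin -sumEFin; apply: le_trans (H3 i).
  under eq_bigr do rewrite -nuP.
  have tr : trivIset [set` (index_enum 'I_n)] P.
    by apply/trivIsetP => k l _ _ /Pd.
  rewrite -big_filter -ge0_integral_bigsetU//; last 3 first.
    exact: filter_uniq (index_enum_uniq _).
    by apply/trivIsetP => k l _ _ /Pd.
    by move=> y _; rewrite lee_fin.
  apply: weighted_mono; first by apply: bigsetU_measurable.
    exact: measurable_mball.
  rewrite -bigcup_seq => y [j /=]; rewrite mem_filter => /andP[/andP[ji /asboolP[z [/ballP iz
    /ballP jz]]] _] /PB /ballP jy.
  apply/ballP; rewrite metric_sym in jz.
  by apply: (lt_le_trans (mdist_lt_trans (mdist_lt_trans iz jz) jy)); lra.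
apply: (@le_trans _ _ (\sum_(j | good j) a i * al j)).
  rewrite (bigID (fun j => `[< (Bi i `&` Bi j) !=set0 >])) /= [X in _ + X]big1 ?addr0; last first.
    move=> j /andP[_ /asboolPn ne]; rewrite /w /q [X in mu X](_ : _ = set0) ?measure0 ?mulr0//.
    by apply/seteqP; split => // z hz; apply: ne; exists z.
  apply: ler_sum => j _; rewrite /w -mulrA ler_wpM2l//.
  by rewrite /a -mulrA ler_piMr// mulrC ler_pdivrMr// mul1r.
rewrite -mulr_sumr; apply: (le_trans (ler_wpM2l (a0 i) sumgood)).
by rewrite (_ : a i * (t * m i) = t * al i)// /a; field; rewrite gt_eqF.
Qed.

End coverings.

(** * The weak type (1,1) inequality *)

Section weak_type.
Context (d : measure_display) (R : realType) (X : measurableMetricType d R).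
Variables (mu : {measure set X -> \bar R}) (lambda : X -> R -> R).
Variables (K : X -> X -> R[i]) (T : (X -> R[i]) -> X -> R[i]).
Hypothesis bX : borel_space X.
Hypothesis gd : geometrically_doubling X.
Hypothesis ud : upper_doubling mu lambda.
Hypothesis cz : cz_operator mu lambda K T.
Hypothesis T2 : L2_bounded mu T.
Variables (CK c delta A L B : R).
Hypotheses (CK0 : 0 < CK) (delta0 : 0 < delta) (L1 : 1 <= L) (B0 : 0 <= B).
Hypotheses (A7 : 7 <= A) (Ac : 1 <= A * c).
Hypothesis Ksize : forall x y, x <> y ->
  normc (K x y) <= CK / lambda x (mdist x y) /\ normc (K x y) <= CK / lambda y (mdist x y).
Hypothesis Ksmooth : forall x x' y, x <> y -> x' <> y -> mdist x x' <= c * mdist x y ->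
  normc (K x y - K x' y) + normc (K y x - K y x') <=
  CK * (mdist x x' `^ delta / (mdist x y `^ delta * lambda x (mdist x y))).
Hypothesis HL : forall x r, 0 < r -> lambda x (A * r) <= L * lambda x r.
Hypothesis TB : forall f, bounded_bsupp f ->
  (\int[mu]_x (normc (T f x) ^+ 2)%:E <= B%:E * \int[mu]_x (normc (f x) ^+ 2)%:E)%E.

Let A1 : 1 < A. Proof. by apply: lt_le_trans A7; rewrite ltr1n. Qed.
Let A0 : 0 < A. Proof. exact: lt_trans A1. Qed.
Let mu_lty := measure_ball_lty ud.

(** A c >= 1 brings y into the range of the smoothness condition, and A > 1 separates x' from y. *)
Lemma kernel_smooth_far x x' y r : 0 < r -> mdist x x' <= r -> A * r <= mdist x y ->
  normc (K x y - K x' y) + normc (K y x - K y x') <=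
  CK * (r `^ delta / (mdist x y `^ delta * lambda x (mdist x y))).
Proof.
move=> r0 xx' xy.
have Ar : r < A * r by rewrite ltr_pMl.
have d0 : 0 < mdist x y by apply: lt_le_trans xy; rewrite mulr_gt0.
apply: le_trans (Ksmooth _ _ _) _.
- by move=> e; move: d0; rewrite e mdistxx ltxx.
- move=> e; move: (lt_le_trans Ar xy); rewrite -e; apply/negP; rewrite -leNgt//.
- apply: (le_trans xx'); apply: (@le_trans _ _ (c * (A * r))).
    by rewrite mulrA [c * A]mulrC ler_peMl// ltW.
  rewrite ler_wpM2l//; have := Ac; have := A0; nra.
rewrite ler_wpM2l ?(ltW CK0)// ler_wpM2r ?ge0_ler_powR ?nnegrE ?mdist_ge0 ?(ltW r0) ?(ltW delta0)//.
by rewrite invr_ge0 mulr_ge0 ?powR_ge0// ltW// (dominating_gt0 ud).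
Qed.

(** The size condition is applied at the centre x, and smoothness moves x to x' for one more CK /
    lambda. All bounds thus refer to lambda at the single centre x. *)
Lemma kernel_size_far x x' z r : 0 < r -> mdist x x' <= r -> A * r <= mdist x z ->
  normc (K z x') <= 2 * CK / lambda x (mdist x z).
Proof.
move=> r0 xx' xz.
have d0 : 0 < mdist x z by apply: lt_le_trans xz; rewrite mulr_gt0.
have l0 : 0 < lambda x (mdist x z) by exact: (dominating_gt0 ud).
have zx : z <> x by move=> e; move: d0; rewrite e mdistxx ltxx.
have [_ s1] := Ksize zx; rewrite metric_sym in s1.
have s2 : normc (K z x - K z x') <= CK / lambda x (mdist x z).
  apply: (@le_trans _ _ (normc (K x z - K x' z) + normc (K z x - K z x'))).
    by rewrite lerDr normc_ge0.
  apply: (le_trans (kernel_smooth_far r0 xx' xz)).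
  rewrite ler_wpM2l ?(ltW CK0)// invfM mulrA ler_piMl ?invr_ge0 ?(ltW l0)//.
  rewrite ler_pdivrMr ?powR_gt0// mul1r ge0_ler_powR ?nnegrE ?(ltW r0) ?(ltW d0) ?(ltW delta0)//.
  by apply: le_trans xz; rewrite ler_peMl// ltW.
have -> : K z x' = K z x + - (K z x - K z x') by ring.
apply: (le_trans (le_normcD _ _)); rewrite normcN.
have -> : 2 * CK / lambda x (mdist x z) = CK / lambda x (mdist x z) + CK / lambda x (mdist x z) by ring.
exact: lerD.
Qed.

(** In place of Cauchy-Schwarz: 2 |T f| <= kap + |T f|^2 / kap pointwise, then the L^2 bound. The
    parameter is chosen later so that both terms become multiples of the mass of a piece. *)
Lemma amgm_integral (D : set X) f (kap : R) : measurable D -> bounded_bsupp f -> 0 < kap ->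
  (\int[mu]_(x in D) (normc (T f x))%:E <=
   2^-1%:E * (kap%:E * mu D + (kap^-1 * B)%:E * \int[mu]_x (normc (f x) ^+ 2)%:E))%E.
Proof.
move=> mD bf kap0.
have mT := operator_measurable bX mu_lty T2 bf.
have mTD : cmeasurable D (T f) by exact: cmeasurableS mT.
have m2 D' : measurable_fun D' (fun x => (normc (T f x) ^+ 2)%:E).
  apply/measurable_EFinP; apply: measurable_funX; apply: measurable_funTS.
  exact: measurable_normc.
apply: (@le_trans _ _ (\int[mu]_(x in D) (2^-1%:E * (kap%:E + kap^-1%:E * (normc (T f x) ^+ 2)%:E)))%E).
  apply: ge0_le_integral => //.
  - by move=> x _; rewrite lee_fin normc_ge0.
  - by apply/measurable_EFinP; exact: measurable_normc.
  - apply: emeasurable_funM; first exact: measurable_cst.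
    apply: emeasurable_funD; first exact: measurable_cst.
    by apply: emeasurable_funM => //; exact: measurable_cst.
  move=> x _; rewrite -(EFinM kap^-1) -EFinD -EFinM lee_fin; set a := normc _.
  have : 0 <= kap^-1 * (kap - a) ^+ 2 by rewrite mulr_ge0 ?sqr_ge0// invr_ge0 ltW.
  have -> : kap^-1 * (kap - a) ^+ 2 = kap - 2 * a + kap^-1 * a ^+ 2.
    by field; rewrite gt_eqF.
  lra.
have p2 (x : X) : (0 <= kap^-1%:E * (normc (T f x) ^+ 2)%:E)%E.
  by rewrite -EFinM lee_fin mulr_ge0 ?sqr_ge0// invr_ge0 ltW.
rewrite ge0_integralZl_EFin//; last 2 first.
  by move=> x _; apply: adde_ge0 => //; rewrite lee_fin ltW.
  apply: emeasurable_funD; first exact: measurable_cst.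
  by apply: emeasurable_funM => //; exact: measurable_cst.
rewrite lee_wpmul2l ?lee_fin ?invr_ge0//.
rewrite ge0_integralD//; last 2 first.
  by move=> x _; rewrite lee_fin ltW.
  by apply: emeasurable_funM => //; exact: measurable_cst.
rewrite integral_cst//; apply: leeD => //.
rewrite ge0_integralZl_EFin//; last 2 first.
  by move=> x _; rewrite lee_fin sqr_ge0.
  by rewrite invr_ge0 ltW.
rewrite EFinM -muleA lee_wpmul2l ?lee_fin ?invr_ge0 ?(ltW kap0)//.
apply: le_trans (TB bf); apply: ge0_subset_integral => //.
by move=> x _; rewrite lee_fin sqr_ge0.
Qed.

(** The terms come from the region beyond A r, where the zero mean is used; from T of the piece
    between rho and A r, by the size of the kernel; and from T of the multiple of the indicator
    there, by the L^2 bound. The factors 6 and 4 are 2 * 3 and 2 * 2, one factor 2 being that of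
    [normc_cintegral_le]. *)
Definition piece_const : R :=
  L ^+ 2 / (1 - (A `^ delta)^-1) * (6 * CK) + 8 * L ^+ 2 * (4 * CK) + (L + 2 * B).

(** * One bad function: a piece minus a multiple of the indicator of a doubling ball *)

Section one_piece.
Variables (x0 : X) (h rho : R) (k : nat) (P : set X) (f : X -> R[i]) (al : R).
Hypotheses (bf : bounded_bsupp f) (h0 : 0 < h) (hrho : h <= rho).
Hypotheses (mP : measurable P) (Ph : P `<=` ball x0 (h / A)).
Hypotheses (Pal : (\int[mu]_(y in P) (normc (f y))%:E = al%:E)%E) (al0 : 0 < al).
Let r := A ^+ k * rho.
Hypotheses (mu0 : (0 < mu (ball x0 r))%E)
  (mu1 : (mu (ball x0 (A ^+ k.+1 * rho)) <= (2 * L)%:E * mu (ball x0 r))%E)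
  (mu2 : forall j, (j <= k)%N ->
     (mu (ball x0 (A ^+ j.+2 * rho)) <= (4 * L ^+ 2 / 2 ^+ (k - j) * lambda x0 (A ^+ j * rho))%:E)%E).

Definition piece_part (y : X) := ((\1_P y)%:C)%C * f y.
Definition piece_avg := cintegral mu setT piece_part * ((fine (mu (ball x0 r)))^-1%:C)%C.
Definition piece_bad (y : X) := piece_part y + - piece_avg * ((\1_(ball x0 r) y)%:C)%C.

Let rho0 : 0 < rho. Proof. exact: lt_le_trans hrho. Qed.
Let r0 : 0 < r. Proof. by rewrite mulr_gt0// exprn_gt0. Qed.
Let rhor : rho <= r. Proof. by rewrite ler_peMl ?(ltW rho0)// exprn_ege1// ltW. Qed.
Let hAr : h / A <= r.
Proof.
apply: le_trans rhor; apply: le_trans hrho.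
by rewrite ler_pdivrMr// ler_peMr ?(ltW h0)// ltW.
Qed.
Let mR : measurable (ball x0 r). Proof. exact: measurable_mball. Qed.
Let mE : mu (ball x0 r) = (fine (mu (ball x0 r)))%:E.
Proof. by rewrite fineK// (measure_ball_fin ud). Qed.
Let m0 : 0 < fine (mu (ball x0 r)). Proof. by rewrite -lte_fin -mE. Qed.

Let one_ball s : 0 < s ->
  (\int[mu]_(y in ball x0 s) (cst 1 y)%:E <= 1%:E * mu (ball x0 (A * s)))%E.
Proof.
move=> s0; change (\int[mu]_(y in ball x0 s) (cst 1%E y) <= 1%:E * mu (ball x0 (A * s)))%E.
rewrite integral_cst; last exact: measurable_mball.
rewrite !mul1e; apply: measure_le; try exact: measurable_mball.
by apply: le_ball; rewrite ler_peMl ?(ltW s0) ?(ltW A1).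
Qed.

Lemma bounded_bsupp_part : bounded_bsupp piece_part.
Proof. exact: bounded_bsupp_indic. Qed.

Lemma bounded_bsupp_bad : bounded_bsupp piece_bad.
Proof.
by apply: bounded_bsuppD; [exact: bounded_bsupp_part|exact: bounded_bsupp_ball].
Qed.

Lemma piece_part_out y : ~ ball x0 (h / A) y -> piece_part y = 0.
Proof.
move=> yP; rewrite /piece_part indicE memNset ?mul0r// => /Ph//.
Qed.

Lemma part_integral D : measurable D -> P `<=` D ->
  (\int[mu]_(y in D) (normc (piece_part y))%:E = al%:E)%E.
Proof.
move=> mD PD; rewrite -Pal [RHS]integral_mkcond [LHS]integral_mkcond; apply: eq_integral => y _.
rewrite !patchE normcM normc_real indicE.
have [yP|yP] := boolP (y \in P); first by rewrite mem_set ?normr1 ?mul1r//; exact/PD/set_mem.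
by case: ifP; rewrite ?normr0 ?mul0r.
Qed.

Lemma normc_avg : normc piece_avg * fine (mu (ball x0 r)) <= 2 * al.
Proof.
rewrite normcM normc_real ger0_norm ?invr_ge0 ?(ltW m0)// mulfVK ?gt_eqF//.
have [mf _ _] := bounded_bsupp_part.
have := normc_cintegral_le mu measurableT mf.
by rewrite part_integral// -EFinM lee_fin.
Qed.

(** The piece contributes al, the multiple of the indicator at most 2 al. *)
Lemma bad_integral : (\int[mu]_(y in ball x0 r) (normc (piece_bad y))%:E <= (3 * al)%:E)%E.
Proof.
have [mp _ _] := bounded_bsupp_part.
have [mb _ _] := bounded_bsupp_bad.
have PR : P `<=` ball x0 r by move=> y /Ph; exact: le_ball.
apply: (@le_trans _ _ (\int[mu]_(y in ball x0 r) ((normc (piece_part y))%:E + (normc piece_avg)%:E))%E).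
  apply: ge0_le_integral => //.
  - by move=> y _; rewrite lee_fin normc_ge0.
  - by apply/measurable_EFinP/measurable_normc; exact: cmeasurableS mb.
  - apply: emeasurable_funD; last exact: measurable_cst.
    by apply/measurable_EFinP/measurable_normc; exact: cmeasurableS mp.
  move=> y yR; rewrite -EFinD lee_fin (le_trans (le_normcD _ _))// lerD2l.
  by rewrite normcM normcN normc_real indicE mem_set// normr1 mulr1.
rewrite ge0_integralD//; last 3 first.
  by move=> y _; rewrite lee_fin normc_ge0.
  by apply/measurable_EFinP/measurable_normc; exact: cmeasurableS mp.
  by move=> y _; rewrite lee_fin normc_ge0.
rewrite part_integral// integral_cst// mE -EFinM -EFinD lee_fin.
have := normc_avg; lra.
Qed.

Lemma bad_mean : cintegral mu (ball x0 r) piece_bad = 0.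
Proof.
rewrite cintegralD//; last 2 first.
  by apply: (bounded_bsupp_cintegrable bX mu_lty) => //; exact: bounded_bsupp_part.
  by apply: (bounded_bsupp_cintegrable bX mu_lty) => //; exact: bounded_bsupp_ball.
have -> : cintegral mu (ball x0 r) (fun y => - piece_avg * ((\1_(ball x0 r) y)%:C)%C) =
    cintegral mu (ball x0 r) (fun=> - piece_avg).
  by apply: eq_cintegral => y yR; rewrite indicE yR mulr1.
rewrite cintegralC// /piece_avg -(@cintegral_mkcond _ _ _ mu (ball x0 r)); last first.
  by move=> y yR; apply: piece_part_out; apply: contra_not yR; exact: le_ball.
rewrite mulNr -mulrA -[X in _ - _ * X](rmorphM (real_complex R)) mulVf ?gt_eqF//.
by rewrite rmorph1 mulr1 subrr.
Qed.

(** Since the bad function has mean zero, K(z, x0) may be subtracted from the kernel under the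
    integral. The kernel formula applies because the support lies in the closed ball of radius r,
    which z avoids. *)
Lemma bad_far : {ae mu, forall z, A * r <= mdist x0 z ->
  normc (T piece_bad z) <= 6 * CK * al * (r `^ delta / (mdist x0 z `^ delta * lambda x0 (mdist x0 z)))}.
Proof.
have rA : r < A * r by rewrite ltr_pMl.
have := operator_kernel cz bounded_bsupp_bad; apply: filterS => z Hz rz.
have bout y : ~ ball x0 r y -> piece_bad y = 0.
  move=> yR; rewrite /piece_bad piece_part_out ?indicE ?memNset ?mulr0 ?addr0//.
  by apply: contra_not yR; exact: le_ball.
have zR : ~ ball x0 r z by move=> /ballP; apply/negP; rewrite -leNgt (le_trans (ltW rA)).
rewrite Hz; last first.
  move=> /(@supp_le _ _ _ x0 r) /= h1; have : mdist x0 z <= r.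
    by apply: h1 => y /(contra_notP (@bout y)) /ballP /ltW.
  by apply/negP; rewrite -ltNge (lt_le_trans rA).
rewrite (@cintegral_mkcond _ _ _ mu (ball x0 r)); last by move=> y /bout ->; rewrite mulr0.
set M := r `^ delta / _.
have M0 : 0 <= CK * M.
  rewrite mulr_ge0 ?(ltW CK0)// divr_ge0 ?powR_ge0// mulr_ge0 ?powR_ge0//.
  by rewrite ltW// (dominating_gt0 ud)// (lt_le_trans r0)// (le_trans (ltW rA)).
have mK : cmeasurable (ball x0 r) (K z) by exact: (kernel_measurable bX cz gd).
have mKd : cmeasurable (ball x0 r) (fun y => K z y - K z x0).
  by apply: cmeasurableD => //; exact: cmeasurable_cst.
have Kb y : ball x0 r y -> normc (K z y - K z x0) <= CK * M.
  move=> /ballP /ltW yr; apply: le_trans (kernel_smooth_far r0 yr rz).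
  by rewrite normc_distC lerDr normc_ge0.
have [i1 b1] := cintegral_bounded_mul bX mu_lty mR mKd bounded_bsupp_bad Kb M0.
have ib : cintegrable mu (ball x0 r) piece_bad.
  by apply: (bounded_bsupp_cintegrable bX mu_lty) => //; exact: bounded_bsupp_bad.
have [i2 _] := cintegral_bounded_mul bX mu_lty mR (@cmeasurable_cst _ _ _ (ball x0 r) (K z x0))
  bounded_bsupp_bad (fun y _ => lexx _) (normc_ge0 _).
have -> : cintegral mu (ball x0 r) (fun y => K z y * piece_bad y) =
    cintegral mu (ball x0 r) (fun y => (K z y - K z x0) * piece_bad y + K z x0 * piece_bad y).
  by apply: eq_cintegral => y _; ring.
rewrite cintegralD// cintegralZ// bad_mean mulr0 addr0.
rewrite -lee_fin; apply: (le_trans b1).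
apply: (@le_trans _ _ (2%:E * ((CK * M)%:E * (3 * al)%:E))%E).
  by rewrite lee_wpmul2l// lee_wpmul2l ?lee_fin//; exact: bad_integral.
by rewrite -!EFinM lee_fin le_eqVlt; apply/orP; left; apply/eqP; ring.
Qed.

(** Too close for cancellation, T b is split as T of the piece minus T psi. The piece lives at scale
    h / A, below all the annuli, so the kernel size and the decay of mu / lambda below the doubling
    scale apply. The function psi lives on the doubling ball, where the whole region has measure at
    most 2 L mu(B(x0, r)) and the L^2 bound suffices. *)
Lemma bad_near_integral :
  (\int[mu]_(z in annulus x0 rho (A ^+ k.+1 * rho)) (normc (T piece_bad z))%:E <=
    (8 * L ^+ 2 * (4 * CK * al) * 1 + (L + 2 * B) * al)%:E)%E.
Proof.
have bp := bounded_bsupp_part; have bb := bounded_bsupp_bad.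
pose psi y := piece_avg * ((\1_(ball x0 r) y)%:C)%C.
have bpsi : bounded_bsupp psi by exact: bounded_bsupp_ball.
have mT g D : bounded_bsupp g -> measurable_fun D (fun z => normc (T g z)).
  move=> bg; apply: measurable_funTS; apply: measurable_normc.
  exact: (operator_measurable bX mu_lty T2 bg).
set E := annulus _ _ _.
have mE' : measurable E by exact: measurable_annulus.
have psum : (fun y => piece_bad y + psi y) = piece_part.
  by apply/funext => y; rewrite /piece_bad /psi mulNr addrNK.
have Tadd := operatorD bX mu_lty cz bb bpsi; rewrite psum in Tadd.
apply: (@le_trans _ _ (\int[mu]_(z in E) ((normc (T piece_part z))%:E + (normc (T psi z))%:E))%E).
  apply: ae_ge0_le_integral => //.
  - by move=> y _; rewrite lee_fin normc_ge0.
  - by apply/measurable_EFinP; exact: mT.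
  - by move=> y _; apply: adde_ge0; rewrite lee_fin normc_ge0.
  - by apply: emeasurable_funD; apply/measurable_EFinP; exact: mT.
  apply: filterS Tadd => z Tz _; rewrite Tz -EFinD lee_fin.
  have {1}-> : T piece_bad z = T piece_bad z + T psi z - T psi z by rewrite addrK.
  by rewrite (le_trans (le_normcD _ _))// normcN.
rewrite ge0_integralD//; last 4 first.
  by move=> y _; rewrite lee_fin normc_ge0.
  by apply/measurable_EFinP; exact: mT.
  by move=> y _; rewrite lee_fin normc_ge0.
  by apply/measurable_EFinP; exact: mT.
rewrite EFinD; apply: leeD.
  apply: (@near_annulus_integral _ _ _ mu lambda bX ud A L x0 rho 1 (4 * CK * al) (cst 1)) => //.
  - by rewrite !mulr_ge0 ?(ltW CK0) ?(ltW al0).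
  - by move=> y; exact: normc_ge0.
  - exact: mT.
  have := operator_kernel cz bp; apply: filterS => z Hz /andP[rz _].
  have hz : h <= mdist x0 z by exact: le_trans rz.
  have hA0 : 0 < h / A by rewrite divr_gt0.
  have hAh : h / A < h by rewrite ltr_pdivrMr// ltr_pMr.
  have zP : ~ ball x0 (h / A) z by move=> /ballP; apply/negP; rewrite -leNgt (le_trans (ltW hAh)).
  rewrite mulr1 Hz; last first.
    move=> /(@supp_le _ _ _ x0 (h / A)) /= h1; have : mdist x0 z <= h / A.
      by apply: h1 => y /(contra_notP (@piece_part_out y)) /ballP /ltW.
    by apply/negP; rewrite -ltNge (lt_le_trans hAh).
  rewrite (@cintegral_mkcond _ _ _ mu (ball x0 (h / A))); last by move=> y /piece_part_out ->; rewrite mulr0.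
  have mB := @measurable_mball _ _ _ bX x0 (h / A).
  have d0 : 0 < mdist x0 z by exact: lt_le_trans hz.
  have M0 : 0 <= 2 * CK / lambda x0 (mdist x0 z).
    by rewrite divr_ge0 ?mulr_ge0 ?(ltW CK0)// ltW// (dominating_gt0 ud).
  have Kb y : ball x0 (h / A) y -> normc (K z y) <= 2 * CK / lambda x0 (mdist x0 z).
    move=> /ballP /ltW yh; apply: (kernel_size_far hA0 yh).
    by rewrite mulrC divfK ?gt_eqF.
  have [_ b1] := cintegral_bounded_mul bX mu_lty mB (kernel_measurable bX cz gd mB zP) bp Kb M0.
  rewrite part_integral// in b1.
  rewrite -lee_fin; apply: (le_trans b1); rewrite -!EFinM lee_fin.
  by rewrite le_eqVlt; apply/orP; left; apply/eqP; field; rewrite gt_eqF// (dominating_gt0 ud).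
pose m := fine (mu (ball x0 r)).
have mgt0 : 0 < m by exact: m0.
have muR : mu (ball x0 r) = m%:E by exact: mE.
(* As mu(E) <= 2 L m and |psi|^2 has integral at most 4 al^2 / m, this parameter yields half of 2 L
   al + 4 B al. *)
have kap0 : 0 < al / m by rewrite divr_gt0.
apply: le_trans (amgm_integral mE' bpsi kap0) _.
have psi2 : (\int[mu]_z (normc (psi z) ^+ 2)%:E <= (4 * al ^+ 2 / m)%:E)%E.
  have -> : (\int[mu]_z (normc (psi z) ^+ 2)%:E = \int[mu]_z ((normc piece_avg ^+ 2)%:E * (\1_(ball
    x0 r) z)%:E))%E.
    apply: eq_integral => z _; rewrite -EFinM /psi normcM normc_real exprMn indicE.
    by case: (_ \in _); rewrite ?normr1 ?normr0 ?expr1n ?expr0n.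
  rewrite ge0_integralZl_EFin//; last 2 first.
    by apply/measurable_EFinP; exact: measurable_indic.
    exact: sqr_ge0.
  rewrite integral_indic// setIT muR -EFinM lee_fin ler_pdivlMr// -mulrA -expr2 -exprMn.
  have -> : 4 * al ^+ 2 = (2 * al) ^+ 2 by ring.
  rewrite lerXn2r ?nnegrE ?mulr_ge0 ?normc_ge0 ?(ltW al0) ?(ltW mgt0)//.
  exact: normc_avg.
have muE : (mu E <= (2 * L * m)%:E)%E.
  apply: le_trans (le_trans mu1 _); last by rewrite muR -EFinM.
  apply: measure_le => //; first exact: measurable_mball.
  by move=> z /andP[_ ?]; apply/ballP.
apply: (@le_trans _ _ (2^-1%:E * ((al / m)%:E * (2 * L * m)%:E + ((al / m)^-1 * B)%:E * (4 * al ^+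
  2 / m)%:E))%E).
  rewrite lee_wpmul2l ?lee_fin ?invr_ge0//; apply: leeD; rewrite lee_wpmul2l ?lee_fin ?(ltW kap0)//.
  by rewrite mulr_ge0 ?invr_ge0 ?(ltW kap0).
rewrite -(EFinM (al / m)) -(EFinM (_ * B)) -EFinD -EFinM lee_fin le_eqVlt; apply/orP; left; apply/eqP; field.
by rewrite !gt_eqF.
Qed.

Lemma bad_out_integral :
  (\int[mu]_(z in ~` ball x0 rho) (normc (T piece_bad z))%:E <= (piece_const * al)%:E)%E.
Proof.
have bb := bounded_bsupp_bad.
have mT D : measurable_fun D (fun z => normc (T piece_bad z)).
  apply: measurable_funTS; apply: measurable_normc.
  exact: (operator_measurable bX mu_lty T2 bb).
have rrho : rho <= A ^+ k.+1 * rho by rewrite ler_peMl ?(ltW rho0)// exprn_ege1// ltW.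
have -> : ~` ball x0 rho = annulus x0 rho (A ^+ k.+1 * rho) `|` [set z | A ^+ k.+1 * rho <= mdist x0 z].
  rewrite setC_mball; apply/seteqP; split => z; rewrite /annulus /=.
    by move=> rz; have [h1|h1] := ltP (mdist x0 z) (A ^+ k.+1 * rho); [left; rewrite rz|right].
  by move=> [/andP[]//|]; exact: le_trans.
rewrite ge0_integral_setU//; last 5 first.
  exact: measurable_annulus.
  exact: measurable_mdist_ge.
  by apply/measurable_EFinP; exact: mT.
  by move=> y _; rewrite lee_fin normc_ge0.
  apply/disj_setPS => y [/= /andP[_ h1] h2].
  by move: (lt_le_trans h1 h2); rewrite ltxx.
have -> : piece_const * al = (8 * L ^+ 2 * (4 * CK * al) * 1 + (L + 2 * B) * al) +
    L ^+ 2 / (1 - (A `^ delta)^-1) * (6 * CK * al) * 1.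
  by rewrite /piece_const; ring.
rewrite EFinD; apply: leeD; first exact: bad_near_integral.
apply: (@far_annulus_integral _ _ _ mu lambda bX ud A L x0 _ 1 (6 * CK * al) (cst 1)) => //.
- by rewrite mulr_gt0// exprn_gt0.
- by rewrite !mulr_ge0 ?(ltW CK0) ?(ltW al0).
- by move=> y; exact: normc_ge0.
apply: filterS bad_far => z Hz rz; rewrite mulr1; apply: le_trans (Hz _) _.
  by rewrite mulrA -exprS.
have d0 : 0 < mdist x0 z by apply: lt_le_trans rz; exact: lt_le_trans rrho.
rewrite ler_wpM2l ?mulr_ge0 ?(ltW CK0) ?(ltW al0)// ler_wpM2r//.
  by rewrite invr_ge0 mulr_ge0 ?powR_ge0// ltW// (dominating_gt0 ud).
rewrite ge0_ler_powR ?nnegrE ?(ltW delta0) ?(ltW r0)//; first exact: le_trans (ltW rho0) rrho.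
by rewrite ler_pM2r// ler_eXn2l.
Qed.

End one_piece.
Let pc := piece_const.

Let pc0 : 0 <= pc.
Proof.
have Ad : 1 < A `^ delta.
  by have := @gt0_ltr_powR R delta delta0 1 A; rewrite powR1; apply; rewrite ?nnegrE// ltW.
have L0 : 0 <= L by exact: le_trans L1.
have CK0' := ltW CK0.
rewrite /pc /piece_const !addr_ge0// ?mulr_ge0 ?sqr_ge0//.
by rewrite invr_ge0 subr_ge0 invf_le1 ?ltW// (lt_trans ltr01).
Qed.

(** The summand 3 pays for the exceptional set. The others are Chebyshev at height tau / 2: for |T
    G|^2, with 4 + 32 L from the L^2 norm of the good part G, and for the sum of the |T b_i|. *)
Definition weak_const : R := 3 + 4 * B * (4 + 32 * L) + 2 * piece_const.

(** * The Calderon-Zygmund decomposition at a fixed level *)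

Section one_function.
Variables (f : X -> R[i]) (tau F : R).
Hypotheses (bf : bounded_bsupp f) (tau0 : 0 < tau) (F0 : 0 < F).
Hypothesis fF : (\int[mu]_y (normc (f y))%:E = F%:E)%E.
(* This bounds the scales at which the means of |f| exceed tau. *)
Hypothesis large : (F%:E < tau%:E * mu setT)%E.

Let nf y := normc (f y).
Let nf0 y : 0 <= nf y. Proof. exact: normc_ge0. Qed.
Let mnf D : measurable_fun D nf.
Proof. by apply: measurable_funTS; apply: measurable_normc; case: bf. Qed.
Let mnfE D : measurable_fun D (fun y => (nf y)%:E).
Proof. exact/measurable_EFinP. Qed.
Let nu D := (\int[mu]_(y in D) (nf y)%:E)%E.

Let nu_le D : measurable D -> (nu D <= F%:E)%E.
Proof. by move=> mD; rewrite -fF; apply: weighted_mono. Qed.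

Let nu_fin D : measurable D -> nu D = (fine (nu D))%:E.
Proof.
move=> mD; rewrite fineK// ge0_fin_numE; first exact: le_lt_trans (nu_le mD) (ltry _).
by apply: integral_ge0 => y _; rewrite lee_fin.
Qed.

(** The balls exhaust X, so their measures tend to [mu setT], which exceeds F / tau by [large]. *)
Lemma large_balls (x : X) (h : R) : 0 < h ->
  exists N, forall k, (N <= k)%N -> (F%:E < tau%:E * mu (ball x (A ^+ k * h)))%E.
Proof.
move=> h0.
pose E k := ball x (A ^+ k * h) : set X.
have mE k : measurable (E k) by exact: measurable_mball.
have UE : \bigcup_k E k = setT.
  apply/seteqP; split => // y _; have [n hn] := exprn_unbounded (mdist x y / h) A1.
  by exists n => //; apply/ballP; rewrite -ltr_pdivrMr.
have mono : {homo E : n m / (n <= m)%N >-> (n <= m)%O}.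
  by move=> n m nm; apply/subsetPset; apply: le_ball; rewrite ler_pM2r// ler_eXn2l.
have cv : mu (E k) @[k --> \oo] --> mu setT.
  by rewrite -UE; apply: nondecreasing_cvg_mu => //; rewrite UE.
have lt : ((F / tau)%:E < mu setT)%E.
  by rewrite EFinM muleC lte_pdivrMl.
have [N _ HN] : \forall k \near \oo, ((F / tau)%:E < mu (E k))%E.
  apply: (cv [set y | ((F / tau)%:E < y)%E]); apply: open_nbhs_nbhs; split => //.
  exact: open_ereal_gt_ereal.
exists N => k Nk; by have := HN k Nk; rewrite /= EFinM muleC lte_pdivrMl.
Qed.

Lemma weak_type_large : (tau%:E * mu [set z | (tau < normc (T f z))%R] <= (weak_const * F)%:E)%E.
Proof.
have [mf [M fM] [x0 [r0 fr]]] := bf.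
have M0 : 0 <= M by exact: le_trans (normc_ge0 _) (fM x0).
pose Om := [set y | tau < nf y].
have mOm : measurable Om by exact: gt_measurable.
have OmF : (tau%:E * mu Om <= F%:E)%E.
  by rewrite -fF -[Om]setTI; apply: chebyshev_gt => //; exact: ltW.
have OmB : Om `<=` ball x0 r0.
  move=> y ty; apply: fr => fy; have : tau < normc (f y) by exact: ty.
  by rewrite fy normc0; apply/negP; rewrite -leNgt ltW.
(* The first bound makes the excess of U over Om cost at most F. The second makes the part of Om
   missed by the pieces, where only |f| <= M is known, contribute at most tau F to the square
   integral; the + 1 avoids a division by zero. *)
pose eps := Num.min (F / tau) (tau * F / (M ^+ 2 + 1)).
have M2 : 0 < M ^+ 2 + 1 by rewrite ltr_wpDl// sqr_ge0.
have eps0 : 0 < eps by rewrite lt_min !divr_gt0// mulr_gt0.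
have eps1 : tau * eps <= F.
  by rewrite mulrC -ler_pdivlMr// ge_min lexx.
have eps2 : M ^+ 2 * eps <= tau * F.
  apply: (@le_trans _ _ ((M ^+ 2 + 1) * eps)); first by rewrite ler_pM2r// lerDl.
  by rewrite mulrC -ler_pdivlMr// ge_min lexx orbT.
have [n [x [P [h [U [h0 mU muU HP [Pd xU small]]]]]]] :=
  small_pieces bX gd mOm OmB (mu_lty x0 r0) (ltW A1) eps0.
have mP i : measurable (P i) by case: (HP i).
have muP i : (0 < mu (P i))%E by case: (HP i).
have Ph i : P i `<=` ball (x i) (h / A) by case: (HP i).
have POm i : P i `<=` Om by case: (HP i).
pose u k := A ^+ k * h.
have u0 k : 0 < u k by rewrite mulr_gt0// exprn_gt0.
have mB y a : measurable (ball y a : set X) by exact: measurable_mball.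
(* The mean is skewed: a triple ball against the next larger ball. Stopping is then the hypothesis
   of [finite_vitali], and not stopping at a doubling scale gives that of [overlap_square]. *)
pose stop i k := ~~ (nu (ball (x i) (3 * u k)) <= tau%:E * mu (ball (x i) (u k.+1)))%E.
have /choice [k Hk] i : exists k0, (k0 = 0%N \/ stop i k0) /\ forall k, (k0 < k)%N -> ~~ stop i k.
  apply: last_index; have [N HN] := large_balls (x i) h0; exists N => k Nk.
  rewrite negbK; apply: (le_trans (nu_le (mB _ _))); apply: ltW; apply: HN.
  exact: leqW.
pose rho i := A ^+ k i * h.
have rho0 i : 0 < rho i by exact: u0.
have hrho i : h <= rho i by rewrite ler_peMl ?(ltW h0)// exprn_ege1// ltW.
have hAh : h / A <= h by rewrite ler_pdivrMr// ler_peMr ?(ltW h0) ?(ltW A1).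
have /choice [m Hm] i : exists m, [/\ (1 <= m)%N, (0 < mu (ball (x i) (A ^+ m * rho i)))%E,
    (mu (ball (x i) (A ^+ m.+1 * rho i)) <= (2 * L)%:E * mu (ball (x i) (A ^+ m * rho i)))%E &
    forall j, (j <= m)%N ->
      (mu (ball (x i) (A ^+ j.+2 * rho i)) <= (4 * L ^+ 2 / 2 ^+ (m - j) * lambda (x i) (A ^+ j *
        rho i))%:E)%E].
  (* The ball of radius rho_i already contains the piece P_i, which has positive measure. *)
  apply: (doubling_ball bX ud (ltW A1) L1 (rho0 i) HL); exists 0%N.
  apply: (lt_le_trans (muP i)); apply: measure_le => // y /Ph; apply: le_ball.
  by rewrite expr0 mul1r (le_trans hAh).
pose r i := A ^+ m i * rho i.
have rhor i : rho i <= r i by rewrite ler_peMl ?(ltW (rho0 i))// exprn_ege1// ltW.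
pose mr i := fine (mu (ball (x i) (r i))).
have mrE i : mu (ball (x i) (r i)) = (mr i)%:E by rewrite fineK// (measure_ball_fin ud).
have mr0 i : 0 < mr i by rewrite -lte_fin -mrE; case: (Hm i).
pose al i := fine (nu (P i)).
have alE i : nu (P i) = (al i)%:E by exact: nu_fin.
have al0 i : 0 < al i.
  rewrite -lte_fin -alE; apply: (@lt_le_trans _ _ (tau%:E * mu (P i))%E).
    by rewrite mule_gt0.
  have := chebyshev_gt mu (mP i) (@mnf (P i)) nf0 (ltW tau0).
  by rewrite (_ : P i `&` _ = P i)//; apply/setIidPl; exact: POm.
have alF : \sum_i al i <= F.
  rewrite -lee_fin -sumEFin; under eq_bigr do rewrite -alE.
  rewrite /nu -ge0_integral_bigsetU//; last 3 first.
    exact: index_enum_uniq.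
    by apply/trivIsetP => i j _ _ /Pd.
    by move=> y _; rewrite lee_fin.
  by apply: nu_le; apply: bigsetU_measurable.
pose b i := piece_bad (x i) (rho i) (m i) (P i) f.
have bb i : bounded_bsupp (b i) by exact: bounded_bsupp_bad.
have bout i : (\int[mu]_(z in ~` ball (x i) (rho i)) (normc (T (b i) z))%:E <= (pc * al i)%:E)%E.
  have [_ h1 h2 h3] := Hm i.
  exact: (bad_out_integral bf h0 (hrho i) (mP i) (@Ph i) (alE i) (al0 i) h1 h2 h3).
(* The good part: f off the pieces, plus the sum of the c_i 1_{R_i}. *)
pose G y := f y + \sum_(i <- index_enum 'I_n) (-1) * b i y.
have bG : bounded_bsupp G.
  by apply: bounded_bsuppD => //; apply: bounded_bsupp_sum => i; exact: bounded_bsuppZ.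
have fG : (fun y => G y + \sum_(i <- index_enum 'I_n) b i y) = f.
  apply/funext => y; rewrite /G -addrA -big_split /= big1 ?addr0// => i _.
  by rewrite mulN1r addNr.
have Tsum := operator_sum bX mu_lty cz (index_enum 'I_n) bG bb; rewrite fG in Tsum.
have mT g D : bounded_bsupp g -> measurable_fun D (fun z => normc (T g z)).
  move=> bg; apply: measurable_funTS; apply: measurable_normc.
  exact: (operator_measurable bX mu_lty T2 bg).
(* With f0 = f off the pieces, |G|^2 <= 2 |f0|^2 + 8 S^2. The integral of |f0|^2 is at most 2 tau F
   and that of S^2 at most 4 L tau F, whence 4 + 32 L. *)
have Glow : (\int[mu]_z (normc (G z) ^+ 2)%:E <= ((4 + 32 * L) * tau * F)%:E)%E.
  pose Q := \bigcup_(i in [set: 'I_n]) P i.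
  have mQ : measurable Q by apply: fin_bigcup_measurable.
  pose f0 y := f y - \sum_i piece_part (P i) f y.
  pose S y := \sum_i al i / mr i * \1_(ball (x i) (r i)) y.
  have S0 y : 0 <= S y.
    by apply: sumr_ge0 => i _; rewrite mulr_ge0// divr_ge0// ltW.
  (* Off Om, |f|^2 <= tau |f|; on Om off the pieces, |f| <= M on a set of measure below eps; on the
     pieces f0 vanishes. *)
  have f0le y : normc (f0 y) ^+ 2 <= tau * nf y + M ^+ 2 * \1_(Om `\` Q) y.
    have [[j _ Pjy]|Qy] := pselect (Q y).
      have -> : f0 y = 0.
        rewrite /f0 (bigD1 j)//= big1 ?addr0 => [|i ij].
          by rewrite /piece_part indicE mem_set// mul1r subrr.
        rewrite /piece_part indicE memNset ?mul0r// => Piy.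
        by have : (P i `&` P j) y by []; rewrite Pd.
      by rewrite normc0 expr0n addr_ge0// mulr_ge0 ?sqr_ge0 ?(ltW tau0).
    have -> : f0 y = f y.
      rewrite /f0 big1 ?subr0// => i _.
      by rewrite /piece_part indicE memNset ?mul0r// => Piy; apply: Qy; exists i.
    have [Oy|Oy] := pselect (Om y).
      rewrite indicE mem_set//= mulr1 (le_trans (y := M ^+ 2))//; last by rewrite lerDr mulr_ge0// ltW.
      by rewrite lerXn2r// nnegrE normc_ge0.
    rewrite -[leLHS]addr0 lerD//; last by rewrite mulr_ge0 ?sqr_ge0.
    by rewrite expr2 ler_wpM2r ?normc_ge0// leNgt; apply/negP.
  have GE y : normc (G y) <= normc (f0 y) + 2 * S y.
    have -> : G y = f0 y + \sum_i piece_avg (x i) (rho i) (m i) (P i) f * ((\1_(ball (x i) (r i)) y)%:C)%C.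
      rewrite /G /f0 -addrA -sumrN -big_split /=; congr (_ + _); apply: eq_bigr => i _.
      by rewrite /b /piece_bad /r; ring.
    rewrite (le_trans (le_normcD _ _))// lerD2l (le_trans (normc_sum _ _ _))// /S mulr_sumr.
    apply: ler_sum => i _; rewrite normcM normc_real ger0_norm// mulrA ler_wpM2r//.
    rewrite mulrA ler_pdivlMr//; have [_ h1 _ _] := Hm i.
    exact: (normc_avg bf (mP i) (alE i) h1).
  have G2 y : normc (G y) ^+ 2 <= 2 * (tau * nf y + M ^+ 2 * \1_(Om `\` Q) y) + 8 * S y ^+ 2.
    have h1 := f0le y; have h2 := GE y; have h3 := normc_ge0 (G y); have h4 := normc_ge0 (f0 y).
    have h5 := S0 y; move: h1 h2 h3 h4 h5.
    move: (normc (G y)) (normc (f0 y)) (S y) (tau * nf y + _) => a c0 s w h1 h2 h3 h4 h5.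
    apply: (@le_trans _ _ ((c0 + 2 * s) ^+ 2)).
      by rewrite lerXn2r ?nnegrE// addr_ge0// mulr_ge0.
    apply: (@le_trans _ _ (2 * c0 ^+ 2 + 8 * s ^+ 2)); last by rewrite lerD2r ler_pM2l.
    by have := sqr_ge0 (c0 - 2 * s); nra.
  have mS : measurable_fun setT S.
    apply: measurable_sum => i; apply: measurable_funM; first exact: measurable_cst.
    exact: measurable_indic.
  have mOQ : measurable (Om `\` Q) by exact: measurableD.
  have [mG _ _] := bG.
  have mw : measurable_fun setT (fun y => tau * nf y + M ^+ 2 * \1_(Om `\` Q) y).
    apply: measurable_funD; apply: measurable_funM; try exact: measurable_cst.
      exact: mnf.
    exact: measurable_indic.
  have w0 y : 0 <= tau * nf y + M ^+ 2 * \1_(Om `\` Q) y.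
    by rewrite addr_ge0// mulr_ge0 ?sqr_ge0 ?(ltW tau0).
  apply: (@le_trans _ _ (\int[mu]_y (2%:E * (tau * nf y + M ^+ 2 * \1_(Om `\` Q) y)%:E + 8%:E * (S
    y ^+ 2)%:E))%E).
    apply: ge0_le_integral => //.
    - by move=> y _; rewrite lee_fin sqr_ge0.
    - by apply/measurable_EFinP; apply: measurable_funX; exact: measurable_normc.
    - apply: emeasurable_funD; apply: emeasurable_funM; try exact: measurable_cst.
        exact/measurable_EFinP.
      by apply/measurable_EFinP; exact: measurable_funX.
    by move=> y _; rewrite lee_fin; exact: G2.
  rewrite ge0_integralD//; last 4 first.
    by move=> y _; rewrite -EFinM lee_fin mulr_ge0.
    by apply: emeasurable_funM; [exact: measurable_cst|exact/measurable_EFinP].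
    by move=> y _; rewrite -EFinM lee_fin mulr_ge0// sqr_ge0.
    apply: emeasurable_funM; first exact: measurable_cst.
    by apply/measurable_EFinP; exact: measurable_funX.
  have -> : (4 + 32 * L) * tau * F = 2 * (2 * (tau * F)) + 8 * (2 * (2 * L * tau) * F) by ring.
  rewrite (EFinD (2 * (2 * (tau * F)))); apply: leeD.
    rewrite ge0_integralZl_EFin//; last 2 first.
      by move=> y _; rewrite lee_fin.
      exact/measurable_EFinP.
    rewrite EFinM lee_wpmul2l//.
    apply: (@le_trans _ _ (\int[mu]_y (tau%:E * (nf y)%:E + (M ^+ 2)%:E * (\1_(Om `\` Q) y)%:E))%E).
      by [].
    rewrite ge0_integralD//; last 4 first.
      by move=> y _; rewrite -EFinM lee_fin mulr_ge0// ltW.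
      by apply: emeasurable_funM; [exact: measurable_cst|exact: mnfE].
      by move=> y _; rewrite -EFinM lee_fin mulr_ge0// sqr_ge0.
      by apply: emeasurable_funM; [exact: measurable_cst|apply/measurable_EFinP; exact: measurable_indic].
    have -> : 2 * (tau * F) = tau * F + tau * F by ring.
    rewrite EFinD; apply: leeD.
      rewrite ge0_integralZl_EFin ?(ltW tau0)//; first by rewrite fF -EFinM.
      by move=> y _; rewrite lee_fin.
    rewrite ge0_integralZl_EFin ?sqr_ge0//; last by apply/measurable_EFinP; exact: measurable_indic.
    rewrite integral_indic// setIT; apply: (@le_trans _ _ ((M ^+ 2)%:E * eps%:E)%E).
      by rewrite lee_wpmul2l ?lee_fin ?sqr_ge0// ltW.
    by rewrite -EFinM lee_fin.
  rewrite ge0_integralZl_EFin//; last 2 first.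
    by move=> y _; rewrite lee_fin sqr_ge0.
    by apply/measurable_EFinP; exact: measurable_funX.
  rewrite EFinM lee_wpmul2l//.
  apply: (@le_trans _ _ (2 * (2 * L * tau) * \sum_i al i)%:E).
    apply: (@overlap_square _ _ _ mu bX nf nf0 (@mnf setT) n x r al mr P) => //.
    - move=> i y /Ph; apply: le_ball; apply: (le_trans hAh); apply: (le_trans (hrho i)).
      exact: rhor.
    - by move=> i; exact: ltW.
    move=> i; have rE a : A ^+ (m i + a) * rho i = u (m i + a + k i)%N by rewrite /u /rho mulrA -exprD.
    have [m1 _ h2 _] := Hm i; have [_ nst] := Hk i.
    (* As 1 <= m_i, this scale lies beyond the last stopping scale; doubling then replaces the
       measure of the next ball by 2 L times that of B(x_i, r_i). *)
    have := nst (m i + k i)%N; rewrite -[ltnLHS]add0n ltn_add2r => /(_ m1); rewrite negbK.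
    have := rE 0%N; rewrite !addn0 => <- /le_trans; apply.
    rewrite [2 * L * tau]mulrC -mulrA EFinM lee_wpmul2l ?lee_fin ?(ltW tau0)//.
    have := rE 1%N; rewrite addn1 addSn => <-.
    by apply: (le_trans h2); rewrite mrE -EFinM.
  by rewrite lee_fin ler_wpM2l// !mulr_ge0 ?(ltW tau0)// (le_trans ler01).
(* The exceptional set contains every B(x_i, rho_i): if k_i = 0 then rho_i = h and the ball lies in
   U, otherwise scale k_i stops and the ball belongs to the Vitali family. *)
pose Ex := U `|` \bigcup_(i in [set` [seq i <- index_enum 'I_n | stop i (k i)]]) ball (x i) (rho i).
have mV : measurable (\bigcup_(i in [set` [seq i <- index_enum 'I_n | stop i (k i)]]) ball (x i) (rho i)).
  by apply: fin_bigcup_measurable.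
have mEx : measurable Ex by exact: measurableU.
have Exball i : ball (x i) (rho i) `<=` Ex.
  have [[ki|st] _] := Hk i.
    by move=> y yB; left; apply: (xU i); move: yB; rewrite /rho ki expr0 mul1r.
  by move=> y yB; right; exists i => //=; rewrite mem_filter st mem_index_enum.
(* F for Om, F for the excess eps, and F for the Vitali family. *)
have muEx : (tau%:E * mu Ex <= (3 * F)%:E)%E.
  apply: (@le_trans _ _ (tau%:E * (mu U + mu (\bigcup_(i in [set` [seq i <- index_enum 'I_n | stop
    i (k i)]]) ball (x i) (rho i))))%E).
    by rewrite lee_wpmul2l ?lee_fin ?(ltW tau0)//; exact: measureU2.
  rewrite ge0_muleDr//.
  have -> : 3 * F = (F + F) + F by ring.
  rewrite EFinD; apply: leeD.
    apply: (@le_trans _ _ (tau%:E * (mu Om + eps%:E))%E).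
      by rewrite lee_wpmul2l ?lee_fin ?(ltW tau0).
    by rewrite ge0_muleDr// ?lee_fin ?(ltW eps0)// EFinD; apply: leeD.
  apply: le_trans (finite_vitali (t := tau) bX nf0 (@mnf setT) tau0 A7 rho0 _) _.
    move=> i; rewrite mem_filter => /andP[st _].
    by move: st; rewrite /stop -ltNge /u exprS -mulrA => /ltW.
  by apply: nu_le; apply: fin_bigcup_measurable.
pose E1 := [set z | tau / 2 < normc (T G z)].
pose E2 := ~` Ex `&` [set z | tau / 2 < \sum_i normc (T (b i) z)].
have ms D : measurable_fun D (fun z => \sum_i normc (T (b i) z)).
  by apply: measurable_sum => i; exact: mT.
have mE1 : measurable E1 by apply: gt_measurable; exact: mT.
have mE2 : measurable E2 by apply: measurableI; [exact: measurableC|exact: gt_measurable].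
have muE1 : (tau%:E * mu E1 <= (4 * B * (4 + 32 * L) * F)%:E)%E.
  have t2 : 0 <= (tau / 2) ^+ 2 by exact: sqr_ge0.
  have := chebyshev_gt mu measurableT (measurable_funX 2 (mT G setT bG)) (fun z => sqr_ge0 _) t2.
  rewrite setTI (_ : [set z | _] = E1); last first.
    have t20 : 0 <= tau / 2 by rewrite divr_ge0// ltW.
    by apply/seteqP; split => z; rewrite /E1 /= ltr_pXn2r ?nnegrE ?normc_ge0.
  move=> ch.
  have hB : (((tau / 2) ^+ 2)%:E * mu E1 <= B%:E * ((4 + 32 * L) * tau * F)%:E)%E.
    by apply: (le_trans (le_trans ch (TB bG))); rewrite lee_wpmul2l.
  have -> : 4 * B * (4 + 32 * L) * F = 4 / tau * (B * ((4 + 32 * L) * tau * F)).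
    by field; rewrite gt_eqF.
  have -> : tau%:E = ((4 / tau)%:E * ((tau / 2) ^+ 2)%:E)%E.
    by rewrite -EFinM; congr EFin; field; rewrite gt_eqF.
  by rewrite -muleA (EFinM (4 / tau) (B * _)) lee_wpmul2l ?lee_fin ?divr_ge0 ?(ltW tau0).
have muE2 : (tau%:E * mu E2 <= (2 * pc * F)%:E)%E.
  have t2 : 0 <= tau / 2 by rewrite divr_ge0// ltW.
  have := chebyshev_gt mu (measurableC mEx) (ms (~` Ex)) (fun z => sumr_ge0 _ (fun i _ => normc_ge0 _)) t2.
  rewrite -/E2 => ch.
  have -> : tau%:E = (2%:E * (tau / 2)%:E)%E by rewrite -EFinM; congr EFin; field.
  have -> : 2 * pc * F = 2 * (pc * F) by ring.
  rewrite -muleA (EFinM 2 (pc * F)) lee_wpmul2l//; apply: (le_trans ch).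
  under eq_integral do rewrite -sumEFin.
  rewrite ge0_integral_sum//; last 3 first.
    exact: measurableC.
    by move=> i; apply/measurable_EFinP; exact: mT.
    by move=> i z _; rewrite lee_fin normc_ge0.
  apply: (@le_trans _ _ (\sum_i (pc * al i)%:E)%E).
    apply: lee_sum => i _; apply: le_trans (bout i).
    apply: ge0_subset_integral => //.
    - exact: measurableC.
    - exact/measurableC/measurable_mball.
    - by apply/measurable_EFinP; exact: mT.
    - by move=> z _; rewrite lee_fin normc_ge0.
    - by apply: subsetC; exact: Exball.
  by rewrite sumEFin lee_fin -mulr_sumr ler_wpM2l.
(* Almost everywhere T f is the sum of T G and the T b_i, so off [Ex] one of the two parts exceeds
   tau / 2. *)
have cover : (mu [set z | (tau < normc (T f z))%R] <= mu (Ex `|` E1 `|` E2))%E.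
  apply: measure_le_ae; first by apply: gt_measurable; exact: mT.
    by apply: measurableU => //; exact: measurableU.
  apply: filterS Tsum => z Tz /= tz.
  have [zEx|zEx] := pselect (Ex z); first by left; left.
  have [z1|z1] := ltP (tau / 2) (normc (T G z)); first by left; right.
  right; split => //=; rewrite ltNge; apply/negP => z2.
  move: tz; rewrite Tz; apply/negP; rewrite -leNgt (le_trans (le_normcD _ _))//.
  rewrite [leRHS]splitr lerD//; apply: le_trans z2; exact: normc_sum.
apply: (@le_trans _ _ (tau%:E * (mu Ex + mu E1 + mu E2))%E).
  rewrite lee_wpmul2l ?lee_fin ?(ltW tau0)//; apply: (le_trans cover).
  apply: (le_trans (measureU2 _ _ _)) => //; first exact: measurableU.
  by apply: leeD => //; exact: measureU2.
rewrite !ge0_muleDr ?adde_ge0//.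
have -> : weak_const * F = 3 * F + 4 * B * (4 + 32 * L) * F + 2 * pc * F.
  by rewrite /weak_const /pc; ring.
by rewrite !EFinD; apply: leeD => //; exact: leeD.
Qed.

End one_function.

Lemma weak_const_ge1 : 1 <= weak_const.
Proof.
have L0 : 0 <= L by exact: le_trans L1.
rewrite /weak_const -/pc; have h : 0 <= 4 * B * (4 + 32 * L) by rewrite !mulr_ge0// addr_ge0// mulr_ge0.
by have := pc0; lra.
Qed.

(** If F >= tau mu(X) the bound is immediate with constant 1; otherwise the means are eventually
    below tau and the decomposition applies. F = 0 is treated apart, where the L^2 bound makes the
    left side vanish. *)
Lemma weak_type (f : X -> R[i]) (tau : R) : bounded_bsupp f -> 0 < tau ->
  (tau%:E * mu [set z | (tau < normc (T f z))%R] <= weak_const%:E * \int[mu]_y (normc (f y))%:E)%E.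
Proof.
move=> bf tau0; pose F := fine (\int[mu]_y (normc (f y))%:E)%E.
have fF : (\int[mu]_y (normc (f y))%:E = F%:E)%E.
  rewrite fineK// ge0_fin_numE.
    exact: (bounded_bsupp_int_lty bX mu_lty 0 measurableT bf).
  by apply: integral_ge0 => y _; rewrite lee_fin normc_ge0.
have F0 : 0 <= F by rewrite -lee_fin -fF; apply: integral_ge0 => y _; rewrite lee_fin normc_ge0.
have mTf : measurable_fun setT (fun z => normc (T f z)).
  by apply: measurable_normc; exact: (operator_measurable bX mu_lty T2 bf).
have mE : measurable [set z | tau < normc (T f z)] by exact: gt_measurable.
rewrite fF -EFinM.
have [large|small] := ltP F%:E (tau%:E * mu setT)%E; last first.
  apply: (@le_trans _ _ F%:E); last by rewrite lee_fin ler_peMl// weak_const_ge1.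
  apply: le_trans small; rewrite lee_wpmul2l ?lee_fin ?(ltW tau0)//.
  exact: measure_le.
have [F1|F1] := ltP 0 F; first exact: weak_type_large.
have {F1}F1 : F = 0 by apply/eqP; rewrite eq_le F0 F1.
have [mf [M fM] _] := bf.
have M0 : 0 <= M by exact: le_trans (normc_ge0 _) (fM point).
(* |f|^2 <= M |f|, so a vanishing L^1 norm forces a vanishing L^2 norm. *)
have f2 : (\int[mu]_y (normc (f y) ^+ 2)%:E <= 0)%E.
  apply: (@le_trans _ _ (\int[mu]_y (M%:E * (normc (f y))%:E))%E).
    apply: ge0_le_integral => //.
    - by move=> y _; rewrite lee_fin sqr_ge0.
    - by apply/measurable_EFinP; apply: measurable_funX; exact: measurable_normc.
    - apply: emeasurable_funM; first exact: measurable_cst.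
      by apply/measurable_EFinP; exact: measurable_normc.
    by move=> y _; rewrite -EFinM lee_fin expr2 ler_wpM2r ?normc_ge0.
  rewrite ge0_integralZl_EFin//; last 2 first.
    by move=> y _; rewrite lee_fin normc_ge0.
    by apply/measurable_EFinP; exact: measurable_normc.
  by rewrite fF F1 mule0.
have t2 : 0 <= tau ^+ 2 by exact: sqr_ge0.
have := chebyshev_gt mu measurableT (measurable_funX 2 mTf) (fun z => sqr_ge0 _) t2.
rewrite setTI (_ : [set z | _] = [set z | tau < normc (T f z)]); last first.
  by apply/seteqP; split => z; rewrite /= ltr_pXn2r ?nnegrE ?normc_ge0 ?(ltW tau0).
move=> ch; have {ch}ch : ((tau ^+ 2)%:E * mu [set z | (tau < normc (T f z))%R] <= 0)%E.
  by apply: (le_trans ch); apply: (le_trans (TB bf)); apply: mule_ge0_le0.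
rewrite F1 mulr0; move: ch; rewrite expr2 EFinM -muleA.
have [//|h] := leP (tau%:E * mu [set z | (tau < normc (T f z))%R])%E 0%E.
by rewrite leNgt mule_gt0.
Qed.
End weak_type.

(** * Cotlar's inequality *)

Lemma compact_bounded_ball (R : realType) (X : metricType R) (x : X) (A : set X) : compact A ->
  exists n : nat, A `<=` ball x n%:R.
Proof.
move=> /compact_near_coveringP cA.
have [|N _ HN] := cA nat \oo (fun n y => mdist x y < n%:R) _; last first.
  by exists N => y Ay; rewrite ballEmdist; exact: (HN N (leqnn N) y Ay).
move=> y Ay; exists (ball y 1, [set n | ((Num.truncn (mdist x y)).+2 <= n)%N]).
  split => /=; first exact: nbhsx_ballx.
  by exists (Num.truncn (mdist x y)).+2.
move=> [z n] [/= yz Nn]; rewrite ballEmdist /= in yz.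
apply: (le_lt_trans (metric_triangle x y z)).
apply: (@lt_le_trans _ _ ((Num.truncn (mdist x y)).+1%:R + 1)).
  by apply: ltrD => //; exact: truncnS_gt.
by rewrite natr1 ler_nat.
Qed.

(** * Integral bounds from finite maximal functions *)

Section maximal_function.
Context (d : measure_display) (R : realType) (X : measurableMetricType d R).
Variables (mu : {measure set X -> \bar R}).
Hypothesis bX : borel_space X.

Lemma maximal_fun_ge0 p rho (f : X -> R[i]) x : (0 <= maximal_fun mu p rho f x)%E.
Proof.
apply: le_trans (ereal_sup_ubound _); last first.
  by exists x, 1; split => //; exact: ballxx.
exact: poweR_ge0.
Qed.

Lemma supp_ge x r (f : X -> R[i]) : (forall y, f y <> 0 -> r <= mdist x y) ->
  supp f `<=` [set y | r <= mdist x y].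
Proof.
move=> fr; rewrite -setC_mball.
have cB : closed (~` ball x r : set X) by apply: open_closedC; exact: open_ball.
rewrite [X in _ `<=` X](closure_id _).1//; apply: closure_subset => y /eqP /fr.
by rewrite setC_mball.
Qed.

Hypothesis mu_lty : forall (x : X) r, (mu (ball x r) < +oo)%E.

Lemma maximal_fun_ball p rho (f : X -> R[i]) x s a : 0 < p -> 1 <= rho -> 0 < s ->
  cmeasurable setT f -> maximal_fun mu p rho f x = a%:E ->
  (\int[mu]_(y in ball x s) (normc (f y) `^ p)%:E <= (a `^ p)%:E * mu (ball x (rho * s)))%E.
Proof.
move=> p0 rho1 s0 mf Ma.
have mB r := measurable_mball bX x r.
have m1 : measurable_fun (ball x s) (fun y => (normc (f y) `^ p)%:E).
  apply/measurable_EFinP; apply: measurable_funTS.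
  apply: (measurableT_comp (measurable_powR p)); exact: measurable_normc.
have sub : (mu (ball x s) <= mu (ball x (rho * s)))%E.
  by apply: measure_le => //; apply: le_ball; rewrite ler_peMl// ltW.
(* A dilated ball of measure zero contributes 0 to the supremum and gives no information; but then
   the ball itself is null and so is the integral. *)
have [m0|m0] := eqVneq (mu (ball x (rho * s))) 0%E.
  rewrite m0 mule0 null_set_integral//; apply/eqP; rewrite eq_le measure_ge0 andbT.
  by rewrite -[leRHS]m0.
have := ereal_sup_ubound (_ : [set m : \bar R | exists (z : X) (r : R),
    [/\ 0 < r, ball z r x &
      m = (((mu (ball z (rho * r)))^-1 *
            \int[mu]_(y in ball z r) (normc (f y) `^ p)%:E) `^ p^-1)%E]] _).
move/(_ _ (ex_intro _ x (ex_intro _ s (And3 s0 (ballxx x s0) erefl)))).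
rewrite -/(maximal_fun mu p rho f x) Ma.
set J := (\int[mu]_(y in _) _)%E.
have J0 : (0 <= J)%E by apply: integral_ge0 => y _; rewrite lee_fin powR_ge0.
pose m := fine (mu (ball x (rho * s))).
have mE : mu (ball x (rho * s)) = m%:E by rewrite fineK// ge0_fin_numE.
have mgt0 : 0 < m by rewrite -lte_fin -mE lt0e m0 measure_ge0.
rewrite mE inver gt_eqF// => H.
have y0 : (0 <= (m^-1)%:E * J)%E by apply: mule_ge0 => //; rewrite lee_fin invr_ge0 ltW.
have a0 : 0 <= a by rewrite -lee_fin; apply: le_trans H; exact: poweR_ge0.
have : ((m^-1)%:E * J <= (a `^ p)%:E)%E.
  rewrite -[leLHS]poweRe1// -(mulVf (lt0r_neq0 p0)) poweRrM -poweR_EFin.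
  by apply: gt0_ler_poweR => //; rewrite ?(ltW p0)// in_itv/= ?leey ?andbT ?poweR_ge0 ?lee_fin.
by rewrite lee_pdivrMl// muleC.
Qed.

End maximal_function.

Section cotlar.
Context (d : measure_display) (R : realType) (X : measurableMetricType d R).
Variables (mu : {measure set X -> \bar R}) (lambda : X -> R -> R).
Variables (K : X -> X -> R[i]) (T : (X -> R[i]) -> X -> R[i]).
Hypothesis bX : borel_space X.
Hypothesis gd : geometrically_doubling X.
Hypothesis ud : upper_doubling mu lambda.
Hypothesis cz : cz_operator mu lambda K T.
Hypothesis T2 : L2_bounded mu T.
Variables (CK c delta A L W eta : R).
Hypotheses (CK0 : 0 < CK) (delta0 : 0 < delta) (L1 : 1 <= L) (W0 : 0 < W) (eta0 : 0 < eta).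
Hypotheses (A7 : 7 <= A) (Ac : 1 <= A * c).
Hypothesis Ksize : forall x y, x <> y ->
  normc (K x y) <= CK / lambda x (mdist x y) /\ normc (K x y) <= CK / lambda y (mdist x y).
Hypothesis Ksmooth : forall x x' y, x <> y -> x' <> y -> mdist x x' <= c * mdist x y ->
  normc (K x y - K x' y) + normc (K y x - K y x') <=
  CK * (mdist x x' `^ delta / (mdist x y `^ delta * lambda x (mdist x y))).
(* The kernel is compared at scale A r, and 5 A r is the next scale. *)
Hypothesis HL : forall x r, 0 < r -> lambda x (5 * A * r) <= L * lambda x r.
Hypothesis weak : forall f tau, bounded_bsupp f -> 0 < tau ->
  (tau%:E * mu [set z | (tau < normc (T f z))%R] <= W%:E * \int[mu]_y (normc (f y))%:E)%E.

Let A0 : 0 < A. Proof. by apply: lt_le_trans A7; rewrite ltr0n. Qed.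
Let A51 : 1 < 5 * A. Proof. by have := A7; lra. Qed.
Let mu_lty := measure_ball_lty ud.

Definition far_const : R := 2 * (L ^+ 2 / (1 - ((5 * A) `^ delta)^-1) * CK).

(** The terms come from the annuli below the cut, from smoothness beyond it, from the Chebyshev
    threshold for |T f|^eta, whose root brings in 1 / eta, and from the weak type threshold for T
    f1. *)
Definition cotlar_const : R :=
  2 * (8 * L ^+ 2 * CK) + far_const + (8 * L) `^ eta^-1 + 8 * L * W.

Lemma far_const_ge0 : 0 <= far_const.
Proof.
have Ad : 1 < (5 * A) `^ delta.
  have := @gt0_ltr_powR R delta delta0 1 (5 * A); rewrite powR1; apply; rewrite ?nnegrE//.
  by rewrite mulr_ge0// ltW.
have L0 : 0 <= L by exact: le_trans L1.
rewrite /far_const !mulr_ge0 ?(ltW CK0)//.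
by rewrite invr_ge0 subr_ge0 invf_le1 ?ltW// (lt_trans ltr01).
Qed.

Lemma cotlar_const_gt0 : 0 < cotlar_const.
Proof.
have L0 : 0 < L by exact: lt_le_trans L1.
rewrite /cotlar_const ltr_wpDl ?mulr_gt0// addr_ge0 ?powR_ge0// addr_ge0 ?far_const_ge0//.
by rewrite !mulr_ge0 ?(ltW CK0) ?(ltW L0).
Qed.

(** * One truncation at one point *)

Section one_truncation.
Variables (f : X -> R[i]) (x : X) (eps a b : R).
Hypotheses (bf : bounded_bsupp f) (eps0 : 0 < eps).
Hypothesis Ha : maximal_fun mu eta 6 (T f) x = a%:E.
Hypothesis Hb : maximal_fun mu 1 5 f x = b%:E.

Let nf y := normc (f y).
Let nf0 y : 0 <= nf y. Proof. exact: normc_ge0. Qed.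
Let mf : cmeasurable setT f. Proof. by case: bf. Qed.
Let mnf : measurable_fun setT nf. Proof. exact: measurable_normc. Qed.
Let a0 : 0 <= a. Proof. by rewrite -lee_fin -Ha; exact: maximal_fun_ge0. Qed.
Let b0 : 0 <= b. Proof. by rewrite -lee_fin -Hb; exact: maximal_fun_ge0. Qed.

Let ball5 s : 0 < s -> (\int[mu]_(y in ball x s) (nf y)%:E <= b%:E * mu (ball x (5 * s)))%E.
Proof.
move=> s0; have := maximal_fun_ball bX mu_lty ltr01 (_ : 1 <= 5) s0 mf Hb.
rewrite ler1n => /(_ isT); rewrite powRr1//.
by under eq_integral do rewrite powRr1 ?normc_ge0//.
Qed.

(** Weakened from 5 s to 5 A s, the ratio of scales used by the annulus estimates. *)
Let ballA s : 0 < s -> (\int[mu]_(y in ball x s) (nf y)%:E <= b%:E * mu (ball x (5 * A * s)))%E.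
Proof.
move=> s0; apply: (le_trans (ball5 s0)); rewrite lee_wpmul2l ?lee_fin//.
apply: measure_le; try exact: measurable_mball.
by apply: le_ball; rewrite ler_pM2r// ler_peMr//; have := A7; lra.
Qed.

Let ball6 s : 0 < s ->
  (\int[mu]_(y in ball x s) (normc (T f y) `^ eta)%:E <= (a `^ eta)%:E * mu (ball x (6 * s)))%E.
Proof.
move=> s0; apply: maximal_fun_ball => //; first by rewrite ler1n.
exact: (operator_measurable bX mu_lty T2 bf).
Qed.

Variable (k : nat).
Let r := (5 * A) ^+ k * eps.
Hypotheses (mu0 : (0 < mu (ball x r))%E)
  (mu1 : (mu (ball x ((5 * A) ^+ k.+1 * eps)) <= (2 * L)%:E * mu (ball x r))%E)
  (mu2 : forall j, (j <= k)%N ->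
     (mu (ball x ((5 * A) ^+ j.+2 * eps)) <= (4 * L ^+ 2 / 2 ^+ (k - j) * lambda x ((5 * A) ^+ j *
       eps))%:E)%E).

Let r0 : 0 < r. Proof. by rewrite mulr_gt0// exprn_gt0// mulr_gt0. Qed.
Let epsr : eps <= r. Proof. by rewrite ler_peMl ?(ltW eps0)// exprn_ege1// ltW. Qed.
Let rS : (5 * A) ^+ k.+1 * eps = 5 * A * r. Proof. by rewrite exprS -mulrA. Qed.
Let r_A : r < A * r. Proof. by rewrite ltr_pMl//; have := A7; lra. Qed.
Let E := [set y | A * r <= mdist x y].
Let mE : measurable E. Proof. exact: measurable_mdist_ge. Qed.

Lemma truncation_integrable e : 0 < e ->
  cintegrable mu [set y | e <= mdist x y] (fun y => K x y * f y).
Proof.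
move=> e0; have mD := measurable_mdist_ge bX x e.
have Dx : ~ [set y | e <= mdist x y] x by rewrite /= mdistxx => /(lt_le_trans e0); rewrite ltxx.
have Kb y : [set y | e <= mdist x y] y -> normc (K x y) <= CK / lambda x e.
  move=> /= ey; have xy : x <> y by move=> xy; apply: Dx; rewrite {2}xy.
  have [h _] := Ksize xy; apply: (le_trans h).
  have le0 := dominating_gt0 ud x e0.
  rewrite ler_wpM2l ?(ltW CK0)// lef_pV2 ?posrE//; first exact: (dominating_le ud).
  exact: lt_le_trans le0 (dominating_le ud _ e0 ey).
have [] // := cintegral_bounded_mul bX mu_lty mD (kernel_measurable bX cz gd mD Dx) bf Kb.
by rewrite divr_ge0 ?(ltW CK0)// ltW// (dominating_gt0 ud).
Qed.

(** The region eps <= d < A r is enlarged to d < 5 A r, a whole number of annuli. The cut itself is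
    at A r, so that the ball carrying f1, dilated by 5, is exactly the next scale. *)
Lemma truncation_near :
  normc (truncated_op mu K eps f x - truncated_op mu K (A * r) f x) <= 2 * (8 * L ^+ 2 * CK) * b.
Proof.
have Ar0 : 0 < A * r by rewrite mulr_gt0.
have dU : [set y | eps <= mdist x y] = annulus x eps (A * r) `|` E.
  apply/seteqP; split => y; rewrite /annulus /E /=.
    by move=> ey; have [h|h] := ltP (mdist x y) (A * r); [left; rewrite ey|right].
  by move=> [/andP[]//|]; apply: le_trans; apply: (le_trans epsr); exact: ltW.
rewrite /truncated_op dU cintegral_setU//; last 3 first.
  exact: measurable_annulus.
  apply/disj_setPS => y [/= /andP[_ h1] h2].
  by move: (lt_le_trans h1 h2); rewrite ltxx.
  by rewrite -dU; exact: truncation_integrable.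
rewrite addrK.
have mk (a1 b1 : R) : 0 < a1 -> cmeasurable (annulus x a1 b1) (fun y => K x y * f y).
  move=> a10; apply: cmeasurableM; last exact: cmeasurableS mf.
  apply: (kernel_measurable bX cz gd); first exact: measurable_annulus.
  by rewrite /annulus /= mdistxx leNgt a10.
have mA1 (a1 b1 : R) : measurable (annulus x a1 b1) by exact: measurable_annulus.
rewrite -lee_fin; apply: (le_trans (normc_cintegral_le mu (mA1 _ _) (mk _ _ eps0))).
have -> : 2 * (8 * L ^+ 2 * CK) * b = 2 * (8 * L ^+ 2 * CK * b) by ring.
rewrite (EFinM 2) lee_wpmul2l//.
apply: (@le_trans _ _ (\int[mu]_(y in annulus x eps ((5 * A) ^+ k.+1 * eps)) (normc (K x y * f y))%:E)%E).
  apply: ge0_subset_integral => //.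
  - by apply/measurable_EFinP; apply: measurable_normc; exact: mk.
  - by move=> y _; rewrite lee_fin normc_ge0.
  move=> y /andP[h1 h2]; apply/andP; split => //; apply: (lt_le_trans h2).
  by rewrite rS ler_pM2r//; have := A7; lra.
apply: (@near_annulus_integral _ _ _ mu lambda bX ud (5 * A) L x eps b CK nf) => //.
- exact: ltW.
- by move=> y; exact: normc_ge0.
- by apply: measurable_normc; exact: mk.
apply: aeW => y /andP[ey _].
have xy : x <> y by move=> xy; move: ey; rewrite xy mdistxx leNgt eps0.
have [h _] := Ksize xy.
by rewrite normcM ler_wpM2r// normc_ge0.
Qed.

Let f1 y := ((\1_(ball x (A * r)) y)%:C)%C * f y.
Let f2 y := ((\1_(~` ball x (A * r)) y)%:C)%C * f y.

Let bf1 : bounded_bsupp f1.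
Proof. by apply: bounded_bsupp_indic => //; exact: measurable_mball. Qed.

Let bf2 : bounded_bsupp f2.
Proof. by apply: bounded_bsupp_indic => //; apply: measurableC; exact: measurable_mball. Qed.

Let f12 : (fun y => f1 y + f2 y) = f.
Proof.
apply/funext => y; rewrite /f1 /f2 -mulrDl !indicE in_setC.
by case: (_ \in _); rewrite /= ?addr0 ?add0r mul1r.
Qed.

(** For x' in B(x, r), x' is off the support of f2, so the kernel formula represents T f2 at x' as
    an integral over the same region as the truncation at x; smoothness controls the difference of
    the two. *)
Lemma truncation_far : {ae mu, forall x', ball x r x' ->
  normc (truncated_op mu K (A * r) f x) <= normc (T f x') + normc (T f1 x') + far_const * b}.
Proof.
have Tadd := operatorD bX mu_lty cz bf1 bf2; rewrite f12 in Tadd.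
have Tk := operator_kernel cz bf2.
apply: filterS2 Tadd Tk => x' Tadd Tk /ballP xx'.
have Ex' : ~ E x' by rewrite /E /= => h; move: (lt_trans (le_lt_trans h xx') r_A); rewrite ltxx.
have Ex : ~ E x by rewrite /E /= mdistxx leNgt mulr_gt0.
have f2E y : ~ E y -> f2 y = 0.
  move=> Ey; rewrite /f2 setC_mball indicE memNset ?mul0r//.
have f2f y : E y -> f2 y = f y.
  by move=> Ey; rewrite /f2 setC_mball indicE mem_set ?mul1r.
have mKx : cmeasurable E (K x) by exact: (kernel_measurable bX cz gd).
have mKx' : cmeasurable E (K x') by exact: (kernel_measurable bX cz gd).
have mKd : cmeasurable E (fun y => K x y - K x' y).
  apply: cmeasurableD => //.
  have -> : (fun y => - K x' y) = (fun y => (-1) * K x' y) by apply/funext => y; rewrite mulN1r.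
  by apply: cmeasurableM => //; exact: cmeasurable_cst.
pose u (y : X) := CK * (r `^ delta / (mdist x y `^ delta * lambda x (mdist x y))).
have Ku y : E y -> normc (K x y - K x' y) <= u y.
  move=> Ey; apply: le_trans (kernel_smooth_far ud CK0 delta0 A7 Ac Ksmooth r0 (ltW xx') Ey).
  by rewrite lerDl normc_ge0.
have Ar0 : 0 < A * r by rewrite mulr_gt0.
have uC y : E y -> u y <= CK * ((A * r) `^ delta / (mdist x y `^ delta * lambda x (mdist x y))).
  move=> Ey; have d0 : 0 < mdist x y by exact: lt_le_trans Ey.
  rewrite ler_wpM2l ?(ltW CK0)// ler_wpM2r//.
    by rewrite invr_ge0 mulr_ge0 ?powR_ge0// ltW// (dominating_gt0 ud).
  by rewrite ge0_ler_powR ?nnegrE ?(ltW delta0) ?(ltW r0) ?(ltW Ar0) ?(ltW r_A).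
have intf2 : T f2 x' = cintegral mu E (fun y => K x' y * f y).
  rewrite Tk.
    rewrite (@cintegral_mkcond _ _ _ mu E); last by move=> y /f2E ->; rewrite mulr0.
    by apply: eq_cintegral => y /set_mem Ey; rewrite f2f.
  move=> /(@supp_ge _ _ _ x (A * r)) h; apply: Ex'; apply: h => y f2y.
  by have := contra_notP (@f2E y) f2y.
have iKx : cintegrable mu E (fun y => K x y * f y) by exact: truncation_integrable.
have mkd : cmeasurable E (fun y => (K x y - K x' y) * f y).
  by apply: cmeasurableM => //; exact: cmeasurableS mf.
have farI : (\int[mu]_(y in E) (normc ((K x y - K x' y) * f y))%:E <=
    (L ^+ 2 / (1 - ((5 * A) `^ delta)^-1) * CK * b)%:E)%E.
  apply: (@far_annulus_integral _ _ _ mu lambda bX ud (5 * A) L x (A * r) b CK nf) => //.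
  - exact: ltW.
  - by move=> y; exact: normc_ge0.
  - exact: measurable_normc.
  apply: aeW => y Ey; rewrite normcM ler_wpM2r ?normc_ge0//.
  exact: le_trans (Ku y Ey) (uC y Ey).
have ikd : cintegrable mu E (fun y => (K x y - K x' y) * f y).
  by apply: cintegrableP => //; apply: (le_lt_trans farI); rewrite ltry.
have diff : cintegral mu E (fun y => K x y * f y) =
    T f2 x' + cintegral mu E (fun y => (K x y - K x' y) * f y).
  have ikx' : cintegrable mu E (fun y => K x' y * f y).
    have -> : (fun y => K x' y * f y) = (fun y => K x y * f y + (-1) * ((K x y - K x' y) * f y)).
      by apply/funext => y; ring.
    by apply: cintegrableD => //; exact: cintegrableZ.
  rewrite intf2 -cintegralD//; apply: eq_cintegral => y _; ring.
rewrite /truncated_op -/E diff (le_trans (le_normcD _ _))// lerD//.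
  have -> : T f2 x' = T f x' - T f1 x' by rewrite Tadd addrAC subrr add0r.
  by rewrite (le_trans (le_normcD _ _))// normcN.
rewrite -lee_fin; apply: (le_trans (normc_cintegral_le mu mE mkd)).
rewrite /far_const -mulrA (EFinM 2) lee_wpmul2l//.
Qed.

(** A positive kap keeps both thresholds positive when a or b vanishes; it is made arbitrarily small
    at the end. *)
Lemma truncation_bound (kap : R) : 0 < kap ->
  normc (truncated_op mu K eps f x) <= cotlar_const * (a + kap + (b + kap)).
Proof.
move=> kap0.
pose m := fine (mu (ball x r)).
have muE : mu (ball x r) = m%:E by rewrite fineK// (measure_ball_fin ud).
have m0 : 0 < m by rewrite -lte_fin -muE.
have L0 : 0 < L by exact: lt_le_trans L1.
have ak : 0 < a + kap by rewrite ltr_wpDl.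
have bk : 0 < b + kap by rewrite ltr_wpDl.
have mB s : measurable (ball x s : set X) by exact: measurable_mball.
have mT g : bounded_bsupp g -> measurable_fun setT (fun z => normc (T g z)).
  by move=> bg; apply: measurable_normc; exact: (operator_measurable bX mu_lty T2 bg).
(* 8 L is four times the doubling constant 2 L, so each exceptional set takes at most a quarter of
   the ball. *)
pose th1 := 8 * L * (a + kap) `^ eta.
pose th2 := 8 * L * W * (b + kap).
have th10 : 0 < th1 by rewrite !mulr_gt0// powR_gt0.
have th20 : 0 < th2 by rewrite !mulr_gt0.
pose V1 := ball x r `&` [set z | th1 < normc (T f z) `^ eta].
pose V2 := [set z | th2 < normc (T f1 z)].
have mTe : measurable_fun setT (fun z => normc (T f z) `^ eta).
  by apply: (measurableT_comp (measurable_powR eta)); exact: mT.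
have mV1 : measurable V1 by apply: measurableI => //; exact: gt_measurable.
have mV2 : measurable V2 by apply: gt_measurable; exact: mT.
have muV1 : (mu V1 <= (m / 4)%:E)%E.
  have := chebyshev_gt mu (mB r) (measurable_funTS mTe) (fun z => powR_ge0 _ _) (ltW th10).
  rewrite -/V1 => ch.
  rewrite -(lee_pmul2l _ (_ : (0 < th1%:E)%E))// ?lte_fin//.
  apply: (le_trans ch); apply: (le_trans (ball6 r0)).
  apply: (@le_trans _ _ (((a + kap) `^ eta)%:E * (2 * L * m)%:E)%E); last first.
    by rewrite -!EFinM lee_fin le_eqVlt; apply/orP; left; apply/eqP; rewrite /th1; field.
  apply: lee_pmul => //; rewrite ?lee_fin ?powR_ge0//.
    by rewrite ge0_ler_powR ?nnegrE ?(ltW eta0) ?(ltW ak)// lerDl ltW.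
  (* 6 r <= 5 A r: the dilated ball of M_{eta,6} fits in the next scale. *)
  apply: (@le_trans _ _ (mu (ball x ((5 * A) ^+ k.+1 * eps)))).
    by apply: measure_le => //; apply: le_ball; rewrite rS ler_pM2r//; have := A7; lra.
  by apply: (le_trans mu1); rewrite muE.
have muV2 : (mu V2 <= (m / 4)%:E)%E.
  rewrite -(lee_pmul2l _ (_ : (0 < th2%:E)%E))// ?lte_fin//.
  apply: (le_trans (weak bf1 th20)).
  have -> : (\int[mu]_y (normc (f1 y))%:E = \int[mu]_(y in ball x (A * r)) (nf y)%:E)%E.
    rewrite [RHS]integral_mkcond; apply: eq_integral => y _.
    rewrite patchE /f1 normcM normc_real indicE.
    by case: (_ \in _); rewrite ?normr1 ?normr0 ?mul1r ?mul0r.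
  apply: (@le_trans _ _ (W%:E * (b%:E * (2 * L * m)%:E))%E).
    rewrite lee_wpmul2l ?lee_fin ?(ltW W0)//; apply: (le_trans (ball5 _)); first by rewrite mulr_gt0.
    rewrite lee_wpmul2l ?lee_fin// mulrA -rS; apply: (le_trans mu1).
    by rewrite muE -EFinM.
  rewrite -!EFinM lee_fin /th2.
  have -> : 8 * L * W * (b + kap) * (m / 4) = W * ((b + kap) * (2 * L * m)) by field.
  by rewrite ler_pM2l// ler_wpM2r ?lerDl ?(ltW kap0)// !mulr_ge0 ?(ltW L0) ?(ltW m0).
(* Otherwise V1 and V2 would cover B(x, r) up to a null set, and m <= m / 4 + m / 4 with m > 0. *)
have [x' [xx' V1x' V2x' Hx']] : exists x', [/\ ball x r x', ~ V1 x', ~ V2 x' &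
    normc (truncated_op mu K (A * r) f x) <= normc (T f x') + normc (T f1 x') + far_const * b].
  apply: contrapT => nex.
  have : (mu (ball x r) <= mu (V1 `|` V2))%E.
    apply: measure_le_ae => //; first exact: measurableU.
    apply: filterS truncation_far => z Hz xz; apply: contrapT => nV; apply: nex.
    by exists z; split => //; [move=> ?; apply: nV; left|move=> ?; apply: nV; right|exact: Hz].
  move=> /le_trans /(_ (measureU2 _ mV1 mV2)) /le_trans /(_ (leeD muV1 muV2)).
  by rewrite muE -EFinD lee_fin; lra.
have T1 : normc (T f x') <= (8 * L) `^ eta^-1 * (a + kap).
  have : normc (T f x') `^ eta <= th1.
    by rewrite leNgt; apply/negP => h; apply: V1x'.
  have ei : 0 <= eta^-1 by rewrite invr_ge0 ltW.
  move=> /(ge0_ler_powR ei); rewrite !nnegrE powR_ge0 (ltW th10) => /(_ isT isT).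
  rewrite -powRrM divff ?gt_eqF// powRr1 ?normc_ge0// => /le_trans; apply.
  rewrite /th1 powRM ?powR_ge0 ?mulr_ge0 ?(ltW L0)//.
  by rewrite -powRrM divff ?gt_eqF// powRr1// ltW.
have T2' : normc (T f1 x') <= th2 by rewrite leNgt; apply/negP.
have h1 := truncation_near.
have -> : truncated_op mu K eps f x = (truncated_op mu K eps f x - truncated_op mu K (A * r) f x) +
  truncated_op mu K (A * r) f x.
  by rewrite subrK.
apply: (le_trans (le_normcD _ _)); apply: (le_trans (lerD h1 Hx')).
have h2 := far_const_ge0; have h3 : 0 <= (8 * L) `^ eta^-1 by exact: powR_ge0.
have h4 : 0 <= 8 * L ^+ 2 * CK by rewrite !mulr_ge0 ?(ltW CK0) ?(ltW L0).
have h5 : 0 <= 8 * L * W by rewrite !mulr_ge0 ?(ltW L0) ?(ltW W0).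
move: T1 T2'; rewrite /cotlar_const /th2.
move: h2 h3 h4 h5; move: (8 * L ^+ 2 * CK) (8 * L * W) far_const ((8 * L) `^ eta^-1) => q1 q2 q3 q4.
move: (normc (T f x')) (normc (T f1 x')) => n1 n2 h2 h3 h4 h5 t1 t2.
have := mulr_ge0 h2 (ltW ak); have := mulr_ge0 h4 (ltW ak); have := mulr_ge0 h5 (ltW ak).
have := mulr_ge0 h3 (ltW bk).
have := mulr_ge0 h2 (ltW kap0); have := mulr_ge0 h4 (ltW kap0).
nra.
Qed.

End one_truncation.
End cotlar.

Theorem theorem6p6 (d : measure_display) (R : realType)
    (X : measurableMetricType d R) (mu : {measure set X -> \bar R})
    (lambda : X -> R -> R) (K : X -> X -> R[i])
    (T : (X -> R[i]) -> (X -> R[i])) (eta : R) :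
  borel_space X ->
  geometrically_doubling X ->
  upper_doubling mu lambda ->
  cz_operator mu lambda K T ->
  L2_bounded mu T ->
  0 < eta < 1 ->
  exists2 C : R, 0 < C &
    forall (f : X -> R[i]) (x : X),
      cmeasurable setT f ->
      (exists M : R, forall y, normc (f y) <= M) ->
      compact (supp f) ->
      (maximal_op mu K f x <=
       C%:E * (maximal_fun mu eta 6 (T f) x + maximal_fun mu 1 5 f x))%E.
Proof.
move=> bX gd ud cz T2 /andP[eta0 _].
have mu_lty := measure_ball_lty ud.
have [[_ [CK [c [delta [CK0 c0 /andP[delta0 _] Ks Ksm]]]]] _ _] := cz.
have [B B0 TB] := operator_L2 bX mu_lty T2.
have Ksize x y : x <> y ->
    normc (K x y) <= CK / lambda x (mdist x y) /\ normc (K x y) <= CK / lambda y (mdist x y).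
  by move=> xy; split; apply: (le_trans (Ks _ _ xy)); rewrite ler_pM2l// ge_min lexx ?orbT.
(* 7 for the Vitali selection, 1 / c for the smoothness condition. *)
pose A := Num.max 7 c^-1.
have A7 : 7 <= A by rewrite le_max lexx.
have Ac : 1 <= A * c by rewrite -ler_pdivrMr// div1r le_max lexx orbT.
have A0 : 0 < A by apply: lt_le_trans A7; rewrite ltr0n.
(* Two growth constants of lambda: the weak type argument moves by factors of A, the final one by
   factors of 5 A. *)
have [L0 L01 HL0] := dominating_scale ud A0.
have [L L1 HL] := dominating_scale ud (mulr_gt0 (ltr0n R 5) A0).
pose W := weak_const CK delta A L0 B.
have weak f tau : bounded_bsupp f -> 0 < tau ->
    (tau%:E * mu [set z | (tau < normc (T f z))%R] <= W%:E * \int[mu]_y (normc (f y))%:E)%E.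
  exact: (weak_type bX gd ud cz T2 CK0 delta0 L01 B0 A7 Ac Ksize Ksm HL0 TB).
have W0 : 0 < W.
  exact: lt_le_trans ltr01 (weak_const_ge1 CK0 delta0 L01 B0 A7).
pose C := cotlar_const CK delta A L W eta.
have A51 : 1 < 5 * A by move: A7; lra.
have C0 : 0 < C by exact: (cotlar_const_gt0 eta CK0 delta0 L1 W0 A7).
exists C => // f x mf [M fM] cf.
have bf : bounded_bsupp f.
  split => //; first by exists M.
  have [n sn] := compact_bounded_ball x cf; exists x, n%:R => y fy; apply: sn.
  by apply: subset_closure; exact/eqP.
have M1 := maximal_fun_ge0 mu eta 6 (T f) x.
have M2 := maximal_fun_ge0 mu 1 5 f x.
(* If a maximal function is infinite at x, so is the right side, because C > 0. *)
case Ea : (maximal_fun mu eta 6 (T f) x) M1 => [a||]//; last first.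
  by rewrite addye ?gt0_muley ?lte_fin ?leey// gt_eqF// (lt_le_trans _ M2).
case Eb : (maximal_fun mu 1 5 f x) M2 => [b||]//; last first.
  by rewrite addey ?gt0_muley ?lte_fin ?leey.
rewrite !lee_fin => b0 a0; rewrite -EFinD -EFinM.
apply: ge_ereal_sup => _ [eps eps0 <-]; rewrite lee_fin.
(* Without a ball of positive measure among these, [mu] vanishes identically and so do all
   truncations. *)
have [[j muj]|null] := pselect (exists j, (0 < mu (ball x ((5 * A) ^+ j * eps)))%E).
  have [k [_ mu0 mu1 mu2]] := doubling_ball bX ud (ltW A51) L1 eps0 HL (ex_intro _ j muj).
  apply/ler_addgt0Pl => e e0.
  (* The two occurrences of kap, multiplied by C, add up to e. *)
  have kap0 : 0 < e / (2 * C) by rewrite divr_gt0// mulr_gt0.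
  apply: (le_trans (truncation_bound bX gd ud cz T2 CK0 delta0 L1 W0 eta0 A7 Ac Ksize Ksm HL weak
    bf eps0 Ea Eb mu0 mu1 mu2 kap0)).
  rewrite -/C le_eqVlt; apply/orP; left; apply/eqP; field.
  by rewrite gt_eqF.
have muT : mu setT = 0%E.
  apply/(negligibleP mu measurableT).
  have -> : [set: X] = \bigcup_k ball x ((5 * A) ^+ k * eps).
    apply/seteqP; split => // y _; have [n hn] := exprn_unbounded (mdist x y / eps) A51.
    by exists n => //; apply/ballP; rewrite -ltr_pdivrMr.
  apply: negligible_bigcup => k; apply/negligibleP; first exact: measurable_mball.
  by apply/eqP; rewrite eq_le measure_ge0 andbT leNgt; apply/negP => mk; apply: null; exists k.
apply: (@le_trans _ _ 0); last by rewrite mulr_ge0 ?(ltW C0)// addr_ge0.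
have mD := measurable_mdist_ge bX x eps.
have mk : cmeasurable [set y | eps <= mdist x y] (fun y => K x y * f y).
  apply: cmeasurableM; last exact: cmeasurableS mf.
  by apply: (kernel_measurable bX cz gd) => //; rewrite /= mdistxx leNgt eps0.
rewrite -lee_fin; apply: (le_trans (normc_cintegral_le mu mD mk)).
rewrite null_set_integral ?mule0//; first by apply/measurable_EFinP; exact: measurable_normc.
by apply/eqP; rewrite eq_le measure_ge0 andbT -[leRHS]muT; exact: measure_le.
Qed.
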